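(* Consider the $M$-layer delayed hierarchical system described in the context, with interlayer delays $\tau_2,\dots,\tau_M\ge0$. The set of roots $s\in\mathbb{C}$ of its characteristic equation \[ \det\!\Big(sI+L^{(1)}+\sum_{l=2}^{M}e^{-2s\sum_{i=2}^{l}\tau_i}L^{(l)}\Big)=0 \] equals the union of the solution sets of the equations \[ s=0;\qquad s+\lambda^{(1)}=0;\qquad s\,e^{2s\sum_{i=2}^{l}\tau_i}+\lambda^{(l)}=0,\ \ l=2,\dots,M, \] where $\lambda^{(l)}$ ranges over the nonzero eigenvalues of $L^{(l)}$. Moreover, for every initial value $x^{(1)}_0$ all physical-layer states converge to the consensus \[ \lim_{t\to\infty}x^{(1)}(t)=\frac{\mathbf{1}\mathbf{1}^TK}{\mathbf{1}^TK\mathbf{1}}\,x^{(1)}_0,\qquad K=\mathrm{diag}(a_1,\dots,a_{N^{(1)}}), \] if and only if \[ \sum_{i=2}^{l}\tau_i<\frac{\pi}{4\lambda^{(l)}_{\max}},\qquad l=2,\dots,M, \] where $\lambda^{(l)}_{\max}$ is the maximum eigenvalue of $L^{(l)}$.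
   Context: Hierarchical structure. Fix an integer $M\ge 2$ and positive integers $N^{(1)},\dots,N^{(M)}$; set $N^{(M+1)}:=1$. For each $l\in\{1,\dots,M\}$ the $N^{(l)}$ nodes of layer $l$ are partitioned into $N^{(l+1)}$ groups $G^{(l)}_1,\dots,G^{(l)}_{N^{(l+1)}}$ of sizes $k^{(l)}_p\ge1$, numbered consecutively: group $G^{(l)}_p$ consists of nodes $\sum_{m<p}k^{(l)}_m+1,\dots,\sum_{m\le p}k^{(l)}_m$ of layer $l$; for $l\le M-1$, group $G^{(l)}_p$ is subordinate to node $p$ of layer $l+1$. Each group carries a connected undirected graph with binary adjacency matrix; $L^{(l)}_p$ is its Laplacian (degree matrix minus adjacency matrix), $L^{(l)}_D=\mathrm{diag}(L^{(l)}_1,\dots,L^{(l)}_{N^{(l+1)}})$. Weights: positive constants $a_1,\dots,a_{N^{(1)}}$; $a^{(1)}_i=a_i$, $a^{(l+1)}_p=\sum_{i\in G^{(l)}_p}a^{(l)}_i$; $K^{(l)}=\mathrm{diag}(a^{(l)}_1,\dots,a^{(l)}_{N^{(l)}})^{-1}$. For $l=1,\dots,M-1$: $B^{(l)}=\mathrm{diag}(\mathbf{1}_{k^{(l)}_1},\dots,\mathbf{1}_{k^{(l)}_{N^{(l+1)}}})\in\mathbb{R}^{N^{(l)}\times N^{(l+1)}}$ ($\mathbf 1_k$ all-ones column vector), $C^{(l)}=\mathrm{diag}(C^{(l)}_1,\dots,C^{(l)}_{N^{(l+1)}})\in\mathbb{R}^{N^{(l+1)}\times N^{(l)}}$ with each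 row vector $C^{(l)}_p$ having nonnegative entries summing to $1$. $L^{(1)}=K^{(1)}L^{(1)}_D$ and $L^{(l)}=B^{(1)}\cdots B^{(l-1)}K^{(l)}L^{(l)}_DC^{(l-1)}\cdots C^{(1)}$ for $l=2,\dots,M$ (these have real nonnegative eigenvalues). Delayed system ($\tau_l$ is the communication delay between layers $l-1$ and $l$): $\dot x^{(1)}(t)=-K^{(1)}L^{(1)}_Dx^{(1)}(t)+y^{(1)}(t)$, and for $l=2,\dots,M$: $x^{(l)}(t)=C^{(l-1)}x^{(l-1)}(t-\tau_l)$, $y^{(l-1)}(t)=B^{(l-1)}\big[-K^{(l)}L^{(l)}_Dx^{(l)}(t-\tau_l)+y^{(l)}(t-\tau_l)\big]$, with $y^{(M)}\equiv0$; $x^{(1)}(0)=x^{(1)}_0$, and all signals are taken to be zero at negative time arguments. *)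

(* Defs.v *)
From HB Require Import structures.
From mathcomp Require Import all_boot all_order all_algebra.
From mathcomp Require Import all_classical all_reals all_analysis.
From mathcomp Require Import complex.

Unset Strict Implicit.
Unset Printing Implicit Defensive.

Import Order.TTheory GRing.Theory Num.Theory.
Import numFieldNormedType.Exports.
Local Open Scope ring_scope.
Local Open Scope classical_set_scope.

(* LAYERS ARE 0-INDEXED: Rocq layer j (0 <= j < M) is the paper's layer j+1. *)

Section Hier.
Context {R : realType}.

(* node i (0-based) of layer j lies in group p of layer j (which is
   subordinate to node p of layer j+1) *)
Definition inGroup (k : nat -> nat -> nat) (j i p : nat) : bool :=
  ((\sum_(m < p) k j m <= i) && (i < \sum_(m < p.+1) k j m))%N.

Definition hier_struct (M : nat) (N : nat -> nat) (k : nat -> nat -> nat) : Prop :=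
  [/\ (2 <= M)%N, N M = 1%N,
      (forall j p, (j < M)%N -> (p < N j.+1)%N -> (0 < k j p)%N) &
      (forall j, (j < M)%N -> N j = \sum_(p < N j.+1) k j p)%N].

Definition graph_struct (M : nat) (N : nat -> nat) (k : nat -> nat -> nat)
    (A : forall j, 'M[R]_(N j)) : Prop :=
  forall j, (j < M)%N ->
  [/\ (forall u v, A j u v = 0 \/ A j u v = 1),
      (forall u v, A j u v = A j v u),
      (forall (u v : 'I_(N j)) p, inGroup k j u p -> A j u v != 0 -> inGroup k j v p) &
      (forall (u v : 'I_(N j)) p, inGroup k j u p -> inGroup k j v p ->
          connect (fun x y : 'I_(N j) => A j x y != 0) u v)].

Definition lapl {n} (A : 'M[R]_n) : 'M[R]_n :=
  diag_mx (\row_i \sum_(j < n) A i j) - A.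

Variables (N : nat -> nat) (k : nat -> nat -> nat).

Fixpoint aw (a : 'I_(N 0) -> R) (j : nat) : 'I_(N j) -> R :=
  match j as j0 return 'I_(N j0) -> R with
  | 0 => a
  | j'.+1 => fun p => \sum_(i < N j' | inGroup k j' i p) aw a j' i
  end.

Definition Kmx (a : 'I_(N 0) -> R) (j : nat) : 'M[R]_(N j) :=
  invmx (diag_mx (\row_i aw a j i)).

Definition Bmx (j : nat) : 'M[R]_(N j, N j.+1) :=
  \matrix_(i, p) (inGroup k j i p)%:R.

Definition C_struct (M : nat) (C : forall j, 'M[R]_(N j.+1, N j)) : Prop :=
  forall j, (j.+1 < M)%N ->
  [/\ (forall p i, 0 <= C j p i),
      (forall (p : 'I_(N j.+1)) (i : 'I_(N j)), ~~ inGroup k j i p -> C j p i = 0) &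
      (forall p, \sum_i C j p i = 1)].

Fixpoint Bprod (j : nat) : 'M[R]_(N 0, N j) :=
  match j as j0 return 'M[R]_(N 0, N j0) with
  | 0 => 1%:M
  | j'.+1 => Bprod j' *m Bmx j'
  end.

Fixpoint Cprod (C : forall j, 'M[R]_(N j.+1, N j)) (j : nat) : 'M[R]_(N j, N 0) :=
  match j as j0 return 'M[R]_(N j0, N 0) with
  | 0 => 1%:M
  | j'.+1 => C j' *m Cprod C j'
  end.

(* the matrix L^(j+1) of the paper; Lmat 0 = K^(1) L_D^(1) *)
Definition Lmat (A : forall j, 'M[R]_(N j)) (a : 'I_(N 0) -> R)
    (C : forall j, 'M[R]_(N j.+1, N j)) (j : nat) : 'M[R]_(N 0, N 0) :=
  Bprod j *m (Kmx a j *m lapl (A j)) *m Cprod C j.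

(* cumulative delay: cum tau j = tau_0 + ... + tau_(j-1), the paper's
   sum_{i=2}^{j+1} tau_i (tau j is the paper's tau_(j+2)) *)
Definition cum (tau : nat -> R) (j : nat) : R := \sum_(i < j) tau i.

Definition is_solution (M : nat) (A : forall j, 'M[R]_(N j)) (a : 'I_(N 0) -> R)
    (C : forall j, 'M[R]_(N j.+1, N j)) (tau : nat -> R) (x0 : 'cV[R]_(N 0))
    (x y : forall j, R -> 'cV[R]_(N j)) : Prop :=
  [/\ (forall j t, (j < M)%N -> t < 0 -> x j t = 0 /\ y j t = 0),
      x 0%N 0 = x0,
      (forall j t, (j.+1 < M)%N -> 0 <= t -> x j.+1 t = C j *m x j (t - tau j)),
      (forall j t, (j.+1 < M)%N -> 0 <= t ->
          y j t = Bmx j *m (- (Kmx a j.+1 *m lapl (A j.+1)) *m x j.+1 (t - tau j)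
                            + y j.+1 (t - tau j))) &
      (forall t, y M.-1 t = 0) /\
      (forall (i : 'I_(N 0)),
        (forall t, 0 < t -> {for t, continuous (fun s => x 0%N s i ord0)}) /\
        (forall t, 0 <= t ->
          (fun h => h^-1 * (x 0%N (t + h) i ord0 - x 0%N t i ord0)) @ 0^'+ -->
          ((- (Kmx a 0 *m lapl (A 0%N)) *m x 0%N t + y 0%N t) i ord0)))].

End Hier.

Section Cplx.
Context {R : realType}.
Local Open Scope complex_scope.

Definition cexp (z : R[i]) : R[i] :=
  let: Complex u v := z in (expR u)%:C * (cos v +i* sin v).

Definition toC {n m} (L : 'M[R]_(n, m)) : 'M[R[i]]_(n, m) := map_mx (fun r => r%:C) L.

Definition ceig {n} (L : 'M[R]_n) (l : R[i]) : bool := eigenvalue (toC L) l.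

Definition is_max_eig {n} (L : 'M[R]_n) (m : R) : Prop :=
  eigenvalue L m /\ forall mu, eigenvalue L mu -> mu <= m.

End Cplx.

Section Cons.
Context {R : realType}.
Definition consensus {n} (a : 'I_n -> R) (x0 : 'cV[R]_n) : 'cV[R]_n :=
  let Kd := diag_mx (\row_i a i) in
  let one : 'cV[R]_n := const_mx 1 in
  ((one^T *m Kd *m one) ord0 ord0)^-1 *: (one *m one^T *m Kd *m x0).
End Cons.

(* Main.v *)
Require Import Defs.
From HB Require Import structures.
From mathcomp Require Import all_boot all_order all_algebra.
From mathcomp Require Import all_classical all_reals all_analysis.
From mathcomp Require Import complex polyrcf spectral ring lra.
Import Order.TTheory GRing.Theory Num.Theory.
Import numFieldNormedType.Exports.
Local Open Scope ring_scope.
Local Open Scope classical_set_scope.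

(** Write [S_j] for [Kmx j *m lapl (A j)], so that [L_j = Bprod j *m S_j *m Cprod j], and
    [d_j = 2 * cum tau j]. Since [C_j B_j = 1] and [S_j B_j = 0], one has [L_i L_j = 0] for
    [i < j]; hence, for [s <> 0], [det (s + \sum_j c_j L_j)] vanishes iff one of the
    [det (s + c_j L_j)] does.

    Eliminating the upper layers leaves [z' = - \sum_j L_j z(t - d_j)] for the physical layer.
    [S_j] is symmetrizable, so its row space is spanned by real left eigenvectors [r], and the
    scalar [x = r *m Cprod j *m z] satisfies [x' = - l x(t - d_j) + f], where [f] only involves
    the layers below [j]. If [l d_j < pi / 2], an explicit Lyapunov functional shows that [x] is
    square integrable as soon as [f] is; by induction on [j] all [L_j z] are square integrable
    with square integrable derivatives, so they tend to [0]. As [a *m z] is constant and the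
    [L_j] have only the constants as common kernel, [z] tends to the consensus.

    If [l d_j >= pi / 2], the method of steps (all delays [d_i], [i >= j], are positive) gives a
    solution in the range of [Bprod j] for which [f = 0] and [x 0 <> 0]. The equation
    [s + l exp (- s d_j) = 0] has a root [s] with [0 <= Re s], and
    [x t - l \int_(t - d_j)^t exp (s (t - u - d_j)) x u du] is a multiple of [exp (s t)], so
    that [x] cannot tend to [0]. *)

Set Implicit Arguments.
Unset Strict Implicit.
Unset Printing Implicit Defensive.

(** * Right derivatives *)

Section RightDerivative.
Context {R : realType}.
Implicit Types (f g : R -> R) (a b d t l : R).

Definition rd f t l := (fun h => h^-1 * (f (t + h) - f t)) @ 0^'+ --> l.

Lemma near_right0P (P : R -> Prop) :
  (\forall h \near 0^'+, P h) <-> exists2 e, 0 < e & forall h, 0 < h < e -> P h.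
Proof.
split=> [[e /= e0 H]|[e e0 H]].
  exists e => // h /andP[h0 he]; apply: H => //=.
  by rewrite sub0r normrN gtr0_norm.
near=> h; apply: H; apply/andP; split; near: h; [exact: nbhs_right_gt|exact: nbhs_right_lt].
Unshelve. all: by end_near. Qed.

Lemma cvg_near_eq (T : Type) (F : set_system T) {FF : Filter F} (u v : T -> R) l :
  (\forall x \near F, u x = v x) -> u @ F --> l -> v @ F --> l.
Proof. by move=> uv; exact: cvg_trans (near_eq_cvg uv). Qed.

Lemma rd_cvg f t l : rd f t l -> f (t + h) @[h --> 0^'+] --> f t.
Proof.
move=> fl; have h0 : (fun h : R => h) @ 0^'+ --> (0 : R).
  exact: (cvg_at_right_filter cvg_id).
have H : (fun h => f t + h * (h^-1 * (f (t + h) - f t))) @ 0^'+ --> f t + 0 * l.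
  by apply: cvgD; [exact: cvg_cst|exact: cvgM].
rewrite mul0r addr0 in H; apply: cvg_near_eq H; near=> h.
have hn0 : h != 0 by rewrite gt_eqF//; near: h; exact: nbhs_right_gt.
by rewrite mulrA divff// mul1r addrC subrK.
Unshelve. all: by end_near. Qed.

Lemma rd_cst c t : rd (fun=> c) t 0.
Proof.
rewrite /rd; apply: cvg_near_cst; near=> h.
by rewrite subrr mulr0.
Unshelve. all: by end_near. Qed.

Lemma rdD f g t l m : rd f t l -> rd g t m -> rd (fun u => f u + g u) t (l + m).
Proof.
move=> fl gm.
have H : (fun h => h^-1 * (f (t + h) - f t) + h^-1 * (g (t + h) - g t)) @ 0^'+ --> l + m.
  exact: cvgD.
by apply: cvg_near_eq H; apply: nearW => h; ring.
Qed.

Lemma rdM f g t l m : rd f t l -> rd g t m ->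
  rd (fun u => f u * g u) t (l * g t + f t * m).
Proof.
move=> fl gm.
have H : (fun h => (h^-1 * (f (t + h) - f t)) * g (t + h) +
    f t * (h^-1 * (g (t + h) - g t))) @ 0^'+ --> l * g t + f t * m.
  apply: cvgD; apply: cvgM => //; [exact: rd_cvg gm|exact: cvg_cst].
by apply: cvg_near_eq H; apply: nearW => h; ring.
Qed.

Lemma rd_shift f t d l : rd f (t - d) l -> rd (fun u => f (u - d)) t l.
Proof.
move=> H; apply: cvg_near_eq H; apply: nearW => h.
by rewrite addrAC.
Qed.

Lemma rd_near f g t l : f t = g t -> (\forall h \near 0^'+, f (t + h) = g (t + h)) ->
  rd f t l -> rd g t l.
Proof.
move=> fgt fgh H; apply: cvg_near_eq H; near=> h.
rewrite fgt; congr (_ * (_ - _)); near: h; exact: fgh.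
Unshelve. all: by end_near. Qed.

Lemma rd_is_derive f t l : is_derive t 1 f l -> rd f t l.
Proof.
move=> [df dfl]; move: df; rewrite /derivable => /cvg_ex[m /= fm].
have <- : m = l by rewrite -dfl /derive; symmetry; apply: cvg_lim.
have H := cvg_dnbhs_at_right fm.
apply: (@cvg_near_eq _ _ _ _ _ _ _ H); apply: nearW => h /=.
by rewrite /GRing.scale/= mulr1 (addrC h).
Qed.

Lemma rd_le f t l e : rd f t l -> l < e ->
  exists2 dl, 0 < dl & forall h, 0 < h < dl -> f (t + h) <= f t + e * h.
Proof.
move=> fl le; apply/near_right0P.
near=> h.
have h0 : 0 < h by near: h; exact: nbhs_right_gt.
have : h^-1 * (f (t + h) - f t) < e by near: h; exact: (cvgr_lt _ fl).
by rewrite mulrC ltr_pdivrMr// => /ltW; rewrite lerBlDl.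
Unshelve. all: by end_near. Qed.

(* Only right derivatives exist: a delayed input jumps when the initial jump of the state at
   time [0] reaches it. *)
Definition rder a f f' := (forall t, a < t -> {for t, continuous f}) /\
  (forall t, a <= t -> rd f t (f' t)).

Lemma rder_eq a f f' g' : (forall t, a <= t -> f' t = g' t) -> rder a f f' -> rder a f g'.
Proof. by move=> fg [fc fd]; split => // t at_; rewrite -fg//; exact: fd. Qed.

Lemma rder_weak a b f f' : a <= b -> rder a f f' -> rder b f f'.
Proof.
move=> ab [fc fd]; split=> t bt; first by apply: fc; exact: le_lt_trans bt.
by apply: fd; exact: le_trans bt.
Qed.

Lemma rder_cst a c : rder a (fun=> c) (fun=> 0).
Proof. by split=> t _; [exact: cst_continuous|exact: rd_cst]. Qed.

Lemma rderD a f g f' g' : rder a f f' -> rder a g g' ->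
  rder a (fun t => f t + g t) (fun t => f' t + g' t).
Proof.
move=> [fc fd] [gc gd]; split=> t at_; last by apply: rdD; [exact: fd|exact: gd].
by apply: (@continuousD _ R); [exact: fc|exact: gc].
Qed.

Lemma rderM a f g f' g' : rder a f f' -> rder a g g' ->
  rder a (fun t => f t * g t) (fun t => f' t * g t + f t * g' t).
Proof.
move=> [fc fd] [gc gd]; split=> t at_; last by apply: rdM; [exact: fd|exact: gd].
by apply: continuousM; [exact: fc|exact: gc].
Qed.

Lemma rderZ a c f f' : rder a f f' -> rder a (fun t => c * f t) (fun t => c * f' t).
Proof.
move=> /(rderM (rder_cst a c)); apply: rder_eq => t _.
by rewrite mul0r add0r.
Qed.

Lemma rderN a f f' : rder a f f' -> rder a (fun t => - f t) (fun t => - f' t).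
Proof.
move=> /(rderZ (-1)) F.
have -> : (fun t => - f t) = (fun t => -1 * f t) by apply/funext => u; rewrite mulN1r.
by apply: rder_eq F => t _; rewrite mulN1r.
Qed.

Lemma rderB a f g f' g' : rder a f f' -> rder a g g' ->
  rder a (fun t => f t - g t) (fun t => f' t - g' t).
Proof. by move=> F /rderN G; exact: rderD. Qed.

Lemma rder_sum a (I : Type) (r : seq I) (P : pred I) (f f' : I -> R -> R) :
  (forall i, P i -> rder a (f i) (f' i)) ->
  rder a (fun t => \sum_(i <- r | P i) f i t) (fun t => \sum_(i <- r | P i) f' i t).
Proof.
move=> H; elim: r => [|i r IH].
  have -> : (fun t => \sum_(i <- [::] | P i) f i t) = fun=> 0 :> R.
    by apply/funext => t; rewrite big_nil.
  by apply: rder_eq (rder_cst a 0) => t _; rewrite big_nil.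
have [Pi|nPi] := boolP (P i).
  have -> : (fun t => \sum_(i <- i :: r | P i) f i t) =
            fun t => f i t + \sum_(i <- r | P i) f i t.
    by apply/funext => t; rewrite big_cons Pi.
  by apply: rder_eq (rderD (H i Pi) IH) => t _; rewrite big_cons Pi.
have -> : (fun t => \sum_(i <- i :: r | P i) f i t) = fun t => \sum_(i <- r | P i) f i t.
  by apply/funext => t; rewrite big_cons (negbTE nPi).
by apply: rder_eq IH => t _; rewrite big_cons (negbTE nPi).
Qed.

Lemma rder_shift a d f f' : rder (a - d) f f' ->
  rder a (fun t => f (t - d)) (fun t => f' (t - d)).
Proof.
move=> [fc fd]; split=> t at_; last by apply/rd_shift/fd; rewrite lerD2r.
apply: (@continuous_comp _ _ _ (fun t => t - d) f).
  by apply: (@continuousB _ R); [exact: cvg_id|exact: cst_continuous].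
by apply: fc; rewrite ltrD2r.
Qed.

Lemma rder_is_derive a f f' : (forall t : R, is_derive t 1 f (f' t)) -> rder a f f'.
Proof.
move=> H; split=> t _; last exact: rd_is_derive.
by apply: differentiable_continuous; apply/derivable1_diffP; have [] := H t.
Qed.

Lemma rder_id a : rder a id (fun=> 1).
Proof. by apply: rder_is_derive => t; exact: is_derive_id. Qed.

(** For every [e > 0], consider how far the bound by the line of slope [e] through [(a, f a)]
    persists. Left continuity carries the bound to the supremum [c] of these times, and the right
    derivative at [c], being below [e], would push it beyond [c] unless [c = b]. *)
Lemma rd_nonincreasing a b f f' : a <= b ->
  (forall t, a < t <= b -> {for t, continuous f}) ->
  (forall t, a <= t < b -> rd f t (f' t)) ->
  (forall t, a <= t < b -> f' t <= 0) -> f b <= f a.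
Proof.
move=> ab fc fd f'le.
suff H e : 0 < e -> f b <= f a + e * (b - a).
  apply/ler_addgt0Pr => e e0.
  (* The summand 1 keeps the denominator positive when [a = b]. *)
  have := H (e / (b - a + 1)); have ba : 0 < b - a + 1 by rewrite ltr_wpDl// subr_ge0.
  move=> /(_ (divr_gt0 e0 ba)) /le_trans; apply.
  rewrite lerD2l mulrAC ler_pdivrMr// ler_pM2l//.
  by rewrite lerDl.
move=> e0.
pose E := [set t | a <= t <= b /\ forall u, a <= u <= t -> f u <= f a + e * (u - a)].
have Ea : E a.
  split; first by rewrite lexx.
  by move=> u; rewrite -eq_le => /eqP <-; rewrite subrr mulr0 addr0.
have Esup : has_sup E.
  by split; [exists a|exists b => t [/andP[_ tb] _]].
pose c := sup E.
have ac : a <= c by exact: sup_upper_bound.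
have cb : c <= b by apply: ge_sup; [exists a|move=> t [/andP[_ tb] _]].
have Elt u : a <= u < c -> f u <= f a + e * (u - a).
  move=> /andP[au uc]; have uc' : 0 < c - u by rewrite subr_gt0.
  have [t [_ Et] ut] := sup_adherent uc' Esup.
  by apply: Et; rewrite au/= ltW//; move: ut; rewrite -/c; lra.
have Ec : E c.
  split; first by rewrite ac.
  move=> u /andP[au]; rewrite le_eqVlt => /predU1P[->|uc]; last by apply: Elt; rewrite au.
  have [->|ac'] := eqVneq c a; first by rewrite subrr mulr0 addr0.
  have {}ac' : a < c by rewrite lt_neqAle eq_sym ac' ac.
  rewrite leNgt; apply/negP => fca.
  have cl : (fun u => f u - e * (u - a)) @ c --> f c - e * (c - a).
    apply: cvgB; first by apply: fc; rewrite ac'.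
    by apply: cvgM; [exact: cvg_cst|apply: cvgB; [exact: cvg_id|exact: cvg_cst]].
  have fac : f a < f c - e * (c - a) by lra.
  have : \forall u \near c, f a < f u - e * (u - a) by exact: (cvgr_gt _ cl).
  move=> /nbhs_ballP [dl /= dl0 H].
  (* A point of [[a, c)] inside the ball where the bound fails, although it holds at all points
     before [c]. *)
  pose v := Num.max a (c - dl / 2).
  have vc : v < c by rewrite /v gt_max ac'/=; lra.
  have va : a <= v by rewrite /v le_max lexx.
  have := Elt v; rewrite va vc => /(_ isT).
  have /H : ball c dl v.
    rewrite /ball/= ger0_norm ?subr_ge0 1?ltW//.
    have : c - dl / 2 <= v by rewrite /v le_max lexx orbT.
    by lra.
  by move=> /=; lra.
move: cb; rewrite le_eqVlt => /predU1P[cb|cb].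
  by case: Ec => _; apply; rewrite -cb ac lexx.
have f'c : f' c < e by rewrite (le_lt_trans _ e0)// f'le// ac.
have acb : a <= c < b by rewrite ac.
have [dl dl0 H] := rd_le (fd c acb) f'c.
pose t := Num.min b (c + dl / 2).
have ct : c < t by rewrite /t lt_min cb/=; lra.
have tdl : t <= c + dl / 2 by rewrite /t ge_min lexx orbT.
suff Et : E t by have := sup_upper_bound Esup Et; rewrite -/c; lra.
split; first by rewrite (le_trans ac (ltW ct))/= /t ge_min lexx.
move=> u /andP[au ut]; have [uc|uc] := leP u c; first by case: Ec => _; apply; rewrite au.
have := H (u - c); rewrite (addrC c) subrK => /(_ _)/le_trans; apply; first lra.
case: Ec => _ /(_ c); rewrite ac lexx => /(_ isT) ?.
by have := mulrDr e (c - a) (u - c); lra.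
Qed.

Lemma rder_le a b f f' : a <= b -> rder a f f' -> (forall t, a <= t < b -> f' t <= 0) ->
  f b <= f a.
Proof.
move=> ab [fc fd]; apply: rd_nonincreasing ab _ _ => t /andP[at_ _]; [exact: fc|exact: fd].
Qed.

Lemma rder_ge a b f f' : a <= b -> rder a f f' -> (forall t, a <= t < b -> 0 <= f' t) ->
  f a <= f b.
Proof.
move=> ab /rderN F f'ge; rewrite -lerN2; apply: rder_le ab F _ => t /f'ge.
by rewrite oppr_le0.
Qed.

Lemma rder_const a b f f' : a <= b -> rder a f f' -> (forall t, a <= t < b -> f' t = 0) ->
  f b = f a.
Proof.
move=> ab F f'0; apply/eqP; rewrite eq_le (rder_le ab F) ?(rder_ge ab F)// => t /f'0 ->//.
Qed.

End RightDerivative.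

(** * Primitives of signals that vanish before time zero *)

Section Primitive.
Context {R : realType}.
Implicit Types (f g p : R -> R) (a b d t l : R).

(** The signals of the system: at rest before time 0, with a jump allowed at 0 only, where they are
    right continuous. *)
Definition causal f := [/\ (forall t, t < 0 -> f t = 0),
  (forall t, 0 < t -> {for t, continuous f}) & f h @[h --> 0^'+] --> f 0].

Lemma rder_causal f f' : (forall t, t < 0 -> f t = 0) -> rder 0 f f' -> causal f.
Proof.
move=> f0 [fc fd]; split=> //.
have := rd_cvg (fd 0 (lexx _)); under eq_fun do rewrite add0r; exact.
Qed.

Lemma causalM f g : causal f -> causal g -> causal (fun t => f t * g t).
Proof.
move=> [f0 fc fr] [g0 gc gr]; split=> [t t0|t t0|]; first by rewrite f0// mul0r.
  by apply: continuousM; [exact: fc|exact: gc].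
exact: cvgM.
Qed.

Lemma causalMc f g : continuous g -> causal f -> causal (fun t => g t * f t).
Proof.
move=> gc [f0 fc fr]; split=> [t t0|t t0|]; first by rewrite f0// mulr0.
  by apply: continuousM; [exact: gc|exact: fc].
by apply: cvgM => //; apply: cvg_at_right_filter; exact: gc.
Qed.

(* The right primitive of a causal [p] vanishing on [t <= 0]; the integrand is the continuous
   function extending the restriction of [p] to [0 <= t]. *)
Definition rprim p t : R :=
  let F x := (\int[lebesgue_measure]_(u in `[-1, x]) p (Num.max u 0))%R in
  F (Num.max t 0) - F 0.

Lemma rprim0 p t : t <= 0 -> rprim p t = 0.
Proof. by move=> t0; rewrite /rprim max_r// subrr. Qed.

Lemma max0_continuous : continuous (fun t : R => Num.max t 0).
Proof.
move=> t; apply: (@continuous_max _ _ id (fun=> 0)); [exact: cvg_id|exact: cst_continuous].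
Qed.

Lemma causal_max_continuous p : causal p -> continuous (fun t => p (Num.max t 0)).
Proof.
move=> [p0 pc pr] t; have [t0|t0|->] := ltgtP t 0.
- apply: (@cvg_near_eq _ _ _ _ (fun=> p 0)); last first.
    by rewrite /= max_r ?ltW//; exact: cvg_cst.
  near=> u; rewrite max_r//; apply: ltW; near: u; exact: lt_nbhsl.
- apply: (@cvg_near_eq _ _ _ _ p); last by rewrite /= max_l ?ltW//; exact: pc.
  near=> u; rewrite max_l//; apply: ltW; near: u; exact: lt_nbhsr.
- rewrite /continuous_at maxxx; apply/cvgrPdist_lt => e e0.
  move/cvgrPdist_lt : pr => /(_ e e0) /near_right0P[dl dl0 H].
  near=> u; have [u0|u0] := leP u 0; first by rewrite subrr normr0.
  apply: H; rewrite u0/=; near: u; exact: lt_nbhsl.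
Unshelve. all: by end_near. Qed.

(** The integral starts at [-1], so that [Num.max t 0] is always interior and the fundamental
    theorem of calculus also covers time 0. For negative [t] both sides vanish near [t]. *)
Lemma rprimP p a : causal p -> rder a (rprim p) p.
Proof.
move=> cp; have pc := causal_max_continuous cp.
pose q u := p (Num.max u 0).
pose F x := (\int[lebesgue_measure]_(u in `[-1, x]) q u)%R.
have FD x : -1 < x -> derivable F x 1 /\ F^`() x = q x.
  move=> x1; apply: (@continuous_FTC1_closed _ _ _ _ (x + 1)) => //.
  - by rewrite ltrDl.
  - apply: continuous_compact_integrable; first exact: segment_compact.
    by apply: continuous_subspaceT; exact: pc.
  - exact: pc.
have FE t : rprim p t = F (Num.max t 0) - F 0 by [].
have Fc x : -1 < x -> {for x, continuous F}.
  move=> /FD[Fx _]; apply: differentiable_continuous; exact/derivable1_diffP.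
have maxN1 t : -1 < Num.max t 0 by rewrite lt_max ltrN10 orbT.
split=> t _.
  have : {for t, continuous (F \o (fun t => Num.max t 0) - cst (F 0))}.
    apply: (@continuousB _ R); last exact: cst_continuous.
    by apply: continuous_comp; [exact: max0_continuous|exact: Fc].
  by congr {for _, continuous _}.
have [t0|t0] := ltP t 0.
  case: cp => /(_ t t0) -> _ _; apply: (@rd_near _ (fun=> 0)); last exact: rd_cst.
    by rewrite rprim0 ?ltW.
  apply/near_right0P; exists (- t); first by rewrite oppr_gt0.
  by move=> h hh; rewrite rprim0//; lra.
apply: (@rd_near _ (fun t => F t + - F 0)).
- by rewrite FE max_l.
- apply/near_right0P; exists 1 => // h /andP[h0 _].
  by rewrite FE max_l// addr_ge0// ltW.
rewrite -[p t]addr0; apply: rdD; last exact: rd_cst.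
have [|Fd Fq] := FD t; first by rewrite (lt_le_trans _ t0)// ltrN10.
apply: rd_is_derive; split => //; rewrite -derive1E Fq /q max_l//.
Qed.

Lemma rprim_causal p : causal p -> causal (rprim p).
Proof.
by move=> cp; apply: rder_causal (rprimP 0 cp) => t t0; rewrite rprim0// ltW.
Qed.

Lemma rprim_nd p s t : causal p -> (forall u, 0 <= p u) -> s <= t -> rprim p s <= rprim p t.
Proof. by move=> cp p0 st; apply: rder_ge st (rprimP s cp) _ => u _; exact: p0. Qed.

Lemma rprim_ge0 p t : causal p -> (forall u, 0 <= p u) -> 0 <= rprim p t.
Proof.
move=> cp p0; have [t0|t0] := leP t 0; first by rewrite rprim0.
by rewrite -(rprim0 p (lexx 0)); apply: rprim_nd => //; exact: ltW.
Qed.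

Lemma causal_eq f g : f =1 g -> causal f -> causal g.
Proof. by move=> /funext->. Qed.

End Primitive.

(** * A scalar delay equation *)

Section Window.
Context {R : realType}.
Implicit Types (a d t r u : R).

Lemma rder_cosZ (l a : R) : rder a (fun t => cos (l * t)) (fun t => - (l * sin (l * t))).
Proof.
apply: rder_is_derive => t.
have H := @is_deriveZ _ _ _ id l t 1 1 (is_derive_id _ _).
apply: (is_derive_eq (@is_derive1_comp _ cos (l *: id) t _ _ (is_derive_cos _) H)).
by rewrite /GRing.scale/=; ring.
Qed.

Lemma rder_sinZ (l a : R) : rder a (fun t => sin (l * t)) (fun t => l * cos (l * t)).
Proof.
apply: rder_is_derive => t.
have H := @is_deriveZ _ _ _ id l t 1 1 (is_derive_id _ _).
apply: (is_derive_eq (@is_derive1_comp _ sin (l *: id) t _ _ (is_derive_sin _) H)).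
by rewrite /GRing.scale/=; ring.
Qed.

Lemma rder_continuous (f f' : R -> R) : (forall a, rder a f f') -> continuous f.
Proof. by move=> H t; have [+ _] := H (t - 1); apply; rewrite ltrBlDr ltrDl. Qed.

Context (l : R) (x : R -> R).

Definition Cint := rprim (fun u => cos (l * u) * x u).
Definition Sint := rprim (fun u => sin (l * u) * x u).
Definition Yint := rprim (fun u => x u * (sin (l * u) * Cint u - cos (l * u) * Sint u)).
Definition Xsq := rprim (fun u => x u * x u).

(* [cwin t r] and [swin t r] are the integrals of [cos (l * (t - u)) * x u] and
   [sin (l * (t - u)) * x u] over [r <= u <= t]; [zwin t r] is the integral of
   [sin (l * (v - u)) * x u * x v] over [r <= u <= v <= t]. *)
Definition cwin t r := cos (l * t) * (Cint t - Cint r) + sin (l * t) * (Sint t - Sint r).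
Definition swin t r := sin (l * t) * (Cint t - Cint r) - cos (l * t) * (Sint t - Sint r).
Definition zwin t r :=
  Yint t - Yint r - Cint r * (Sint t - Sint r) + Sint r * (Cint t - Cint r).

Lemma winxx t : [/\ cwin t t = 0, swin t t = 0 & zwin t t = 0].
Proof. by rewrite /cwin /swin /zwin !subrr; split; ring. Qed.

Context (xc : causal x).

Lemma CintP a : rder a Cint (fun u => cos (l * u) * x u).
Proof.
by apply: rprimP; apply: causalMc xc; apply: rder_continuous => b; exact: rder_cosZ.
Qed.

Lemma SintP a : rder a Sint (fun u => sin (l * u) * x u).
Proof.
by apply: rprimP; apply: causalMc xc; apply: rder_continuous => b; exact: rder_sinZ.
Qed.

Lemma YintP a :
  rder a Yint (fun u => x u * (sin (l * u) * Cint u - cos (l * u) * Sint u)).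
Proof.
apply: rprimP; apply: causal_eq (causalMc _ xc) => [u|]; first exact: mulrC.
apply: rder_continuous => b.
exact: rderB (rderM (rder_sinZ l b) (CintP b)) (rderM (rder_cosZ l b) (SintP b)).
Qed.

Lemma XsqP a : rder a Xsq (fun u => x u * x u).
Proof. exact/rprimP/causalM. Qed.

Lemma trigsq (u : R) : cos u * cos u = 1 - sin u * sin u.
Proof. by rewrite -!expr2 -(cos2Dsin2 u) addrK. Qed.

(** Derivatives in the left end of the window, with [t] fixed. They turn integral inequalities over
    a window into monotonicity, starting from the empty window, where everything vanishes by
    [winxx]. *)
Lemma cwin_rderr t a : rder a (cwin t) (fun r => - (cos (l * (t - r)) * x r)).
Proof.
have H := rderD (rderZ (cos (l * t)) (rderB (rder_cst a (Cint t)) (CintP a)))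
  (rderZ (sin (l * t)) (rderB (rder_cst a (Sint t)) (SintP a))).
by apply: rder_eq H => r _; rewrite (mulrBr l) cosB; ring.
Qed.

Lemma swin_rderr t a : rder a (swin t) (fun r => - (sin (l * (t - r)) * x r)).
Proof.
have H := rderB (rderZ (sin (l * t)) (rderB (rder_cst a (Cint t)) (CintP a)))
  (rderZ (cos (l * t)) (rderB (rder_cst a (Sint t)) (SintP a))).
by apply: rder_eq H => r _; rewrite (mulrBr l) sinB; ring.
Qed.

Lemma zwin_rderr t a : rder a (zwin t)
  (fun r => - (x r * (sin (l * (t - r)) * cwin t r - cos (l * (t - r)) * swin t r))).
Proof.
have H := rderD (rderB (rderB (rder_cst a (Yint t)) (YintP a))
    (rderM (CintP a) (rderB (rder_cst a (Sint t)) (SintP a))))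
  (rderM (SintP a) (rderB (rder_cst a (Cint t)) (CintP a))).
apply: rder_eq H => r _; rewrite (mulrBr l) sinB cosB /cwin /swin.
ring: (trigsq (l * t)).
Qed.

(** Derivatives along the sliding window of fixed length [d], as needed to differentiate the
    Lyapunov functional in time. The pair [(cwin, swin)] closes up because cosine and sine do. *)
Lemma cwin_rdert d a : rder a (fun t => cwin t (t - d))
  (fun t => x t - cos (l * d) * x (t - d) - l * swin t (t - d)).
Proof.
have H := rderD
  (rderM (rder_cosZ l a) (rderB (CintP a) (rder_shift (CintP (a - d)))))
  (rderM (rder_sinZ l a) (rderB (SintP a) (rder_shift (SintP (a - d))))).
apply: rder_eq H => t _; rewrite /swin.
have -> : l * (t - d) = l * t - l * d by rewrite mulrBr.
rewrite sinB cosB; ring: (trigsq (l * t)).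
Qed.

Lemma swin_rdert d a : rder a (fun t => swin t (t - d))
  (fun t => l * cwin t (t - d) - sin (l * d) * x (t - d)).
Proof.
have H := rderB
  (rderM (rder_sinZ l a) (rderB (CintP a) (rder_shift (CintP (a - d)))))
  (rderM (rder_cosZ l a) (rderB (SintP a) (rder_shift (SintP (a - d))))).
apply: rder_eq H => t _; rewrite /cwin.
have -> : l * (t - d) = l * t - l * d by rewrite mulrBr.
rewrite sinB cosB; ring: (trigsq (l * t)).
Qed.

Lemma zwin_rdert d a : rder a (fun t => zwin t (t - d))
  (fun t => x t * swin t (t - d) - x (t - d) *
     (sin (l * d) * cwin t (t - d) - cos (l * d) * swin t (t - d))).
Proof.
have H := rderD (rderB (rderB (YintP a) (rder_shift (YintP (a - d))))
    (rderM (rder_shift (CintP (a - d))) (rderB (SintP a) (rder_shift (SintP (a - d))))))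
  (rderM (rder_shift (SintP (a - d))) (rderB (CintP a) (rder_shift (CintP (a - d))))).
apply: rder_eq H => t _; rewrite /cwin /swin.
have -> : l * (t - d) = l * t - l * d by rewrite mulrBr.
rewrite sinB cosB; ring: (trigsq (l * t)).
Qed.

End Window.

(** * Square integrability for the forced scalar equation below the threshold *)

Section ScalarDelay.
Context {R : realType}.
Implicit Types (a d t r u : R) (x f F : R -> R).

Lemma Xsq_nd x s t : causal x -> s <= t -> Xsq x s <= Xsq x t.
Proof.
by move=> cx st; apply: rprim_nd => //; [exact: causalM|move=> u; rewrite -expr2 sqr_ge0].
Qed.

Lemma Xsq_ge0 x t : causal x -> 0 <= Xsq x t.
Proof.
by move=> cx; apply: rprim_ge0; [exact: causalM|move=> u; rewrite -expr2 sqr_ge0].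
Qed.

(** The hypothesis is what [0 <= (e - g x) ^ 2] gives when integrated over a window of length [d],
    for [|g| <= 1]. Taking [e = w / (d + 1)] instead of the optimal [w / d] avoids a division by
    zero at [d = 0]. *)
Lemma sqr_window (w : R) d (X : R) : 0 <= d ->
  (forall e, 2 * e * w <= e * e * d + X) -> w * w <= (d + 1) * X.
Proof.
move=> d0 /(_ (w / (d + 1))); have d1 : d + 1 != 0 by lra.
set e := w / (d + 1); have we : w = e * (d + 1) by rewrite /e divfK.
rewrite {1}we => H.
have {}H : e * e * (d + 2) <= X.
  have -> : e * e * (d + 2) = 2 * e * (e * (d + 1)) - e * e * d by ring.
  lra.
rewrite we; have -> : e * (d + 1) * (e * (d + 1)) = (d + 1) * (e * e * (d + 1)) by ring.
apply: ler_wpM2l; first lra.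
apply: le_trans H; apply: ler_wpM2l; last lra.
by rewrite -expr2 sqr_ge0.
Qed.

Lemma window_CauchySchwarz l x d t : causal x -> 0 <= d ->
  cwin l x t (t - d) * cwin l x t (t - d) <= (d + 1) * (Xsq x t - Xsq x (t - d)) /\
  swin l x t (t - d) * swin l x t (t - d) <= (d + 1) * (Xsq x t - Xsq x (t - d)).
Proof.
move=> cx d0; have td : t - d <= t by lra.
have [ct st _] := winxx l x t.
have sq (v : R) : 0 <= v * v by rewrite -expr2 sqr_ge0.
split; apply: sqr_window => // e.
  have H := rderB (rderB (rderZ (e * e) (rderB (rder_cst (t - d) t) (rder_id (t - d))))
     (XsqP cx (t - d))) (rderZ (2 * e) (cwin_rderr l cx t (t - d))).
  lapply (rder_le td H); rewrite /= ?ct; first lra.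
  move=> r _; set k := cos _; have k1 : k * k <= 1.
      by rewrite /k -expr2 -(cos2Dsin2 (l * (t - r))) lerDl sqr_ge0.
    have := sq (e - k * x r); have := sq (x r); have := ler_wpM2r (sq (x r)) k1; lra.
have H := rderB (rderB (rderZ (e * e) (rderB (rder_cst (t - d) t) (rder_id (t - d))))
     (XsqP cx (t - d))) (rderZ (2 * e) (swin_rderr l cx t (t - d))).
lapply (rder_le td H); rewrite /= ?st; first lra.
move=> r _; set k := sin _; have k1 : k * k <= 1.
    by rewrite /k -expr2 -(cos2Dsin2 (l * (t - r))) lerDr sqr_ge0.
  have := sq (e - k * x r); have := sq (x r); have := ler_wpM2r (sq (x r)) k1; lra.
Qed.

Lemma cos_window_gt0 l d u : 0 < l -> l * d < pi / 2 -> 0 <= u <= d -> 0 < cos (l * u).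
Proof.
move=> l0 ld /andP[u0 ud]; apply: cos_gt0_pihalf.
have : 0 <= l * u by rewrite mulr_ge0// ltW.
have : l * u <= l * d by rewrite ler_pM2l.
have := pi_gt0 R; lra.
Qed.

(* The difference of the two sides is a quadratic form whose kernel is the Green function of
   [- w'' - l ^ 2 * w] on a window of length [d] (one Neumann, one Dirichlet end), which is
   positive since [l * d < pi / 2]; concretely, it decreases in the left end of the window. *)
Lemma zwin_le l x d t : causal x -> 0 < l -> 0 <= d -> l * d < pi / 2 ->
  zwin l x t (t - d) + swin l x t (t - d) * cwin l x t (t - d) <=
  tan (l * d) * (cwin l x t (t - d) * cwin l x t (t - d)).
Proof.
move=> cx l0 d0 ld; have td : t - d <= t by lra.
pose c := cwin l x t; pose s := swin l x t; pose z := zwin l x t.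
have [ct st zt] := winxx l x t.
have cg r : t - d <= r <= t -> 0 < cos (l * (t - r)).
  by move=> rr; apply: (cos_window_gt0 l0 ld); lra.
have C a := cwin_rderr l cx t a; have S a := swin_rderr l cx t a.
have Z a := zwin_rderr l cx t a.
have TD r : t - d <= r <= t ->
    is_derive r 1 (fun r => tan (l * (t - r))) (- (l * (cos (l * (t - r))) ^- 2)).
  move=> /cg/lt0r_neq0 cr.
  have H : is_derive r 1 (fun r => l * (t - r)) (- l).
    have H0 := @is_deriveZ _ _ _ (cst t - id) l r 1 _ (is_deriveB (is_derive_cst t r 1) (is_derive_id r 1)).
    by apply: (is_derive_eq H0); rewrite /GRing.scale/=; ring.
  apply: (is_derive_eq (@is_derive1_comp _ tan (fun r => l * (t - r)) r _ _ (is_derive_tan cr) H)).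
  by rewrite /=; ring.
pose P r := tan (l * (t - r)) * (c r * c r) - (z r + s r * c r).
have PE : rder (t - d) (fun r => z r + s r * c r) _ := rderD (Z _) (rderM (S _) (C _)).
have PE' := rderM (C (t - d)) (C (t - d)).
suff : P t <= P (t - d).
  rewrite /P /c /s /z ct st zt; have -> : t - (t - d) = d by ring.
  lra.
apply: (@rd_nonincreasing _ (t - d) t P
  (fun r => - (l * (cos (l * (t - r))) ^- 2 * (c r * c r)))) => // r rr.
- apply: (@continuousB _ R); last by apply: PE.1; lra.
  apply: continuousM; last by apply: PE'.1; lra.
  apply: differentiable_continuous; apply/derivable1_diffP.
  by have [] := TD r; first lra.
- have rr1 : t - d <= r <= t by lra.
  have rr2 : t - d <= r by lra.
  have H := rdD (rdM (rd_is_derive (TD r rr1)) (PE'.2 r rr2)) ((rderN PE).2 r rr2).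
  move: H; rewrite /P; congr rd; rewrite -/c -/s -/z /tan.
  have /lt0r_neq0 := cg r rr1; set co := cos _; set si := sin _ => co0.
  by field.
- rewrite oppr_le0; apply: mulr_ge0; last by rewrite -expr2 sqr_ge0.
  by apply: mulr_ge0; [exact: ltW|rewrite invr_ge0 sqr_ge0].
Qed.

(** The functional [W] below satisfies [W' = - x ^ 2 + (b / l) f m] and is nonnegative by [zwin_le].
    Young's inequality splits the forcing term into a multiple of [f ^ 2], integrable by hypothesis,
    and a small multiple of [m ^ 2], which absorbs only half of the integral of [x ^ 2]. *)
Lemma delay_square_integrable l d x f F F' K : 0 < l -> 0 <= d -> l * d < pi / 2 ->
  (forall t, t < 0 -> x t = 0) ->
  rder 0 x (fun t => - l * x (t - d) + f t) ->
  rder 0 F F' -> (forall t, 0 <= t -> f t * f t <= F' t) -> (forall t, 0 <= t -> F t <= K) ->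
  exists B, forall t, Xsq x t <= B.
Proof.
move=> l0 d0 ld x0 xD FD fF FK; have cx := rder_causal x0 xD.
pose c t := cwin l x t (t - d); pose s t := swin l x t (t - d); pose z t := zwin l x t (t - d).
pose sn := sin (l * d); pose cs := cos (l * d).
have cs0 : 0 < cs by apply: (cos_window_gt0 l0 ld); lra.
have sn0 : 0 <= sn.
  apply: sin_ge0_pi; have : 0 <= l * d by rewrite mulr_ge0// ltW.
  have := pi_gt0 R; lra.
have csn : cs * cs = 1 - sn * sn := trigsq (l * d).
(* This is [tan (pi / 4 + l d / 2)]. The two identities [bcs] and [bsn] are exactly what cancels the
   terms with the delayed value [x (t - d)] in [W']. *)
pose b := (1 + sn) / cs.
have bcs : b * cs = 1 + sn by rewrite /b divfK// gt_eqF.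
have bsn : b - b * sn = cs.
  apply: (@mulIf _ cs); first by rewrite gt_eqF.
  have -> : (b - b * sn) * cs = b * cs * (1 - sn) by ring.
  by rewrite bcs csn; ring.
have cs1 : cs <= 1.
  by have := mulr_ge0 sn0 sn0; rewrite leNgt => ?; apply/negP => ?; nra.
have b1 : 1 <= b by rewrite /b ler_pdivlMr// mul1r; lra.
have b0 : 0 < b by lra.
pose m t := x t - l * s t - l / b * c t.
have cD : rder 0 c (fun t => x t - cs * x (t - d) - l * s t) := cwin_rdert l cx d 0.
have sD : rder 0 s (fun t => l * c t - sn * x (t - d)) := swin_rdert l cx d 0.
have zD : rder 0 z (fun t => x t * s t - x (t - d) * (sn * c t - cs * s t)) :=
  zwin_rdert l cx d 0.
(* [W] is the integral of [x ^ 2] over the future of the unforced equation. *)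
pose W t := b / (2 * l) * (x t * x t) - x t * c t - b * (x t * s t)
  + l * b / 2 * (c t * c t + s t * s t) - l * z t.
have WD : rder 0 W (fun t => - (x t * x t) + b / l * (f t * m t)).
  have := rderB (rderD (rderB (rderB (rderZ (b / (2 * l)) (rderM xD xD)) (rderM xD cD))
     (rderZ b (rderM xD sD))) (rderZ (l * b / 2) (rderD (rderM cD cD) (rderM sD sD))))
     (rderZ l zD).
  apply: rder_eq => t _; rewrite /m.
  have ln0 : l != 0 by rewrite gt_eqF.
  have bn0 : b != 0 by rewrite gt_eqF.
  move: (x t) (x (t - d)) (f t) (c t) (s t) => X Xd f0 c0 s0.
  have E1 : b * cs - (1 + sn) = 0 by rewrite bcs subrr.
  have E2 : b - b * sn - cs = 0 by rewrite bsn subrr.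
  apply/eqP; rewrite -subr_eq0; apply/eqP.
  rewrite -[RHS](_ : (l * Xd * s0 - X * Xd) * (b - b * sn - cs)
     - l * Xd * c0 * (b * cs - (1 + sn)) = 0); last by rewrite E1 E2; ring.
  by field; apply/andP.
have tanb : (b - b^-1) / 2 = tan (l * d).
  rewrite /tan -/sn -/cs; have csn0 : cs != 0 by rewrite gt_eqF.
  have bn0 : b != 0 by rewrite gt_eqF.
  have -> : b^-1 = (1 - sn) / cs.
    apply: (@mulfI _ b) => //; rewrite divff// mulrA mulrBr mulr1 bsn divff//.
  by rewrite /b; field.
(* [m] arises by completing the square in [x t]; by [tanb], what remains of [W] is [l] times the gap
   in [zwin_le]. *)
have Wm t : b / (2 * l) * (m t * m t) <= W t.
  have H := zwin_le t cx l0 d0 ld.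
  rewrite -tanb -/(c t) -/(s t) -/(z t) in H.
  have {}H := ler_wpM2l (ltW l0) H; rewrite -subr_ge0.
  have -> : W t - b / (2 * l) * (m t * m t) =
     l * ((b - b^-1) / 2 * (c t * c t)) - l * (z t + s t * c t).
    by rewrite /W /m; field; rewrite !gt_eqF.
  lra.
have W0 t : 0 <= W t.
  apply: le_trans (Wm t); apply: mulr_ge0; last by rewrite -expr2 sqr_ge0.
  by apply: divr_ge0; [exact: ltW|apply: mulr_ge0 => //; exact: ltW].
(* From [m ^ 2 <= 3 (x ^ 2 + (l s) ^ 2 + (l c / b) ^ 2)]: since [1 <= b], each of the last two
   squares is at most [l ^ 2 (d + 1)] times the window integral of [x ^ 2]. *)
pose c1 := 6 * l ^+ 2 * (d + 1).
have c10 : 0 <= c1.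
  by rewrite /c1; apply: mulr_ge0; [rewrite mulr_ge0 ?sqr_ge0|lra].
(* The weight in Young's inequality, chosen so that the total cost of [e m ^ 2] is at most
   [Xsq x t / 2]; [C2] is the matching coefficient of [f ^ 2]. *)
pose e := (2 * (3 + c1 * d))^-1.
have c1d : 0 <= c1 * d by rewrite mulr_ge0.
have e0 : 0 < e by rewrite /e invr_gt0; lra.
have eE : e * (3 + c1 * d) = 1 / 2 by rewrite /e; field; lra.
pose C2 := b ^+ 2 / (4 * l ^+ 2 * e).
have C20 : 0 <= C2.
  by rewrite /C2 divr_ge0 ?sqr_ge0//; apply: mulr_ge0; [rewrite mulr_ge0 ?sqr_ge0|exact: ltW].
have m2 t : m t * m t <= 3 * (x t * x t) + c1 * (Xsq x t - Xsq x (t - d)).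
  have [H1 H2] := window_CauchySchwarz l t cx d0; rewrite -/(c t) -/(s t) in H1 H2.
  have lb : (l / b) ^+ 2 <= l ^+ 2.
    apply: lerXn2r; rewrite ?nnegrE; [by apply: divr_ge0; exact: ltW|exact: ltW|].
    by rewrite ler_pdivrMr// ler_peMr// ltW.
  have H3 : (l / b) ^+ 2 * (c t * c t) <= l ^+ 2 * ((d + 1) * (Xsq x t - Xsq x (t - d))).
    by apply: ler_pM => //; rewrite -?expr2 ?sqr_ge0.
  have H4 : l ^+ 2 * (s t * s t) <= l ^+ 2 * ((d + 1) * (Xsq x t - Xsq x (t - d))).
    by apply: ler_wpM2l => //; rewrite sqr_ge0.
  have H5 : m t * m t <= 3 * (x t * x t) + 3 * (l ^+ 2 * (s t * s t)) +
      3 * ((l / b) ^+ 2 * (c t * c t)).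
    rewrite /m; set X := x t.
    set p := l * s t; set q := l / b * c t.
    have -> : l ^+ 2 * (s t * s t) = p * p by rewrite /p; ring.
    have -> : (l / b) ^+ 2 * (c t * c t) = q * q by rewrite /q; ring.
    have := sqr_ge0 (X + p); have := sqr_ge0 (X + q); have := sqr_ge0 (p - q).
    by rewrite !expr2; lra.
  by rewrite /c1; lra.
(* The window increment of this second primitive has derivative [Xsq x t - Xsq x (t - d)], the
   delayed term in the bound on [m ^ 2], and is itself at most [d * Xsq x t]. *)
pose XX := rprim (Xsq x).
have Xc : causal (Xsq x) by apply: rprim_causal; exact: causalM.
have XXD a : rder a XX (Xsq x) by exact: rprimP.
have XXle t : XX t - XX (t - d) <= d * Xsq x t.
  have td : t - d <= t by lra.
  have H := rderB (XXD (t - d)) (rderZ (Xsq x t) (rder_id (t - d))).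
  lapply (rder_le td H); rewrite /=; first lra.
  move=> r /andP[_ /ltW rt]; have := Xsq_nd cx rt; lra.
pose H t := W t + Xsq x t - 3 * e * Xsq x t - e * c1 * (XX t - XX (t - d)) - C2 * F t.
have HD : rder 0 H (fun t => - (x t * x t) + b / l * (f t * m t) + x t * x t
   - 3 * e * (x t * x t) - e * c1 * (Xsq x t - Xsq x (t - d)) - C2 * F' t).
  exact: (rderB (rderB (rderB (rderD WD (XsqP cx 0)) (rderZ (3 * e) (XsqP cx 0)))
     (rderZ (e * c1) (rderB (XXD 0) (rder_shift (XXD (0 - d)))))) (rderZ C2 FD)).
exists (2 * (H 0 + C2 * K)) => t.
have [t0|t0] := leP t 0.
  rewrite /Xsq rprim0//; have : 0 <= W 0 by [].
  have := FK 0 (lexx 0); rewrite /H /XX /Xsq !rprim0//; last lra.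
  move=> /(ler_wpM2l C20) FK0 W00; lra.
have : H t <= H 0.
  apply: rder_le (ltW t0) HD _ => u /andP[u0 _].
  have A1 := ler_wpM2l (ltW e0) (m2 u).
  have A2 := ler_wpM2l C20 (fF u u0).
  have A3 : b / l * (f u * m u) <= e * (m u * m u) + C2 * (f u * f u).
    rewrite -subr_ge0.
    have -> : e * (m u * m u) + C2 * (f u * f u) - b / l * (f u * m u) =
       e * (m u - b / (2 * l * e) * f u) ^+ 2.
      by rewrite /C2; field; rewrite !gt_eqF.
    by rewrite mulr_ge0 ?sqr_ge0// ltW.
  lra.
rewrite {1}/H => HH.
have A1 := ler_wpM2l (_ : 0 <= e * c1) (XXle t).
have {}A1 := A1 (mulr_ge0 (ltW e0) c10).
have A2 := ler_wpM2l C20 (FK t (ltW t0)).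
have A3 := W0 t.
have A4 : 3 * e * Xsq x t + e * c1 * (d * Xsq x t) = 1 / 2 * Xsq x t.
  by rewrite -eE; ring.
lra.
Qed.

End ScalarDelay.

(** * Square-integrable signals and their decay *)

Section SquareDominated.
Context {R : realType}.
Implicit Types (a d t r u : R) (x f g h F : R -> R).

(* Square integrability on [0 <= t], stated so that it makes sense for inputs with jumps. *)
Definition sqdom f := exists F F' K, [/\ rder 0 F F',
  (forall t, 0 <= t -> f t * f t <= F' t) & (forall t, 0 <= t -> F t <= K)].

Lemma sqdom0 : sqdom (fun=> 0).
Proof.
exists (fun=> 0), (fun=> 0), 0; split=> [|t _|t _]; [exact: rder_cst|by rewrite mulr0|exact: lexx].
Qed.

Lemma sqdomD f g : sqdom f -> sqdom g -> sqdom (fun t => f t + g t).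
Proof.
move=> [F [F' [K [FD fF FK]]]] [G [G' [L [GD gG GL]]]].
exists (fun t => 2 * F t + 2 * G t), (fun t => 2 * F' t + 2 * G' t), (2 * K + 2 * L); split.
- by apply: rderD; exact: rderZ.
- move=> t t0; have := fF t t0; have := gG t t0; have := sqr_ge0 (f t - g t).
  rewrite expr2; lra.
- by move=> t t0; have := FK t t0; have := GL t t0; lra.
Qed.

Lemma sqdomZ c f : sqdom f -> sqdom (fun t => c * f t).
Proof.
move=> [F [F' [K [FD fF FK]]]].
exists (fun t => c * c * F t), (fun t => c * c * F' t), (c * c * K); split.
- exact: rderZ.
- by move=> t t0; rewrite mulrACA ler_wpM2l ?fF// -expr2 sqr_ge0.
- by move=> t t0; rewrite ler_wpM2l ?FK// -expr2 sqr_ge0.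
Qed.

Lemma sqdom_sum (I : Type) (s : seq I) (P : pred I) (f : I -> R -> R) :
  (forall i, P i -> sqdom (f i)) -> sqdom (fun t => \sum_(i <- s | P i) f i t).
Proof.
move=> H; elim: s => [|i s IH].
  by have -> : (fun t => \sum_(i <- [::] | P i) f i t) = fun=> 0;
    [apply/funext => t; rewrite big_nil|exact: sqdom0].
have [Pi|nPi] := boolP (P i).
  have -> : (fun t => \sum_(i <- i :: s | P i) f i t) =
            fun t => f i t + \sum_(i <- s | P i) f i t.
    by apply/funext => t; rewrite big_cons Pi.
  by apply: sqdomD => //; exact: H.
have -> // : (fun t => \sum_(i <- i :: s | P i) f i t) = fun t => \sum_(i <- s | P i) f i t.
by apply/funext => t; rewrite big_cons (negbTE nPi).
Qed.

Lemma sqdom_Xsq x : causal x -> sqdom x -> exists B, forall t, Xsq x t <= B.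
Proof.
move=> cx [F [F' [K [FD fF FK]]]]; exists (K - F 0) => t.
have [t0|t0] := leP t 0.
  by rewrite /Xsq rprim0// subr_ge0; exact: FK.
lapply (rder_le (ltW t0) (rderB (XsqP cx 0) FD)) => /=.
  by rewrite {2}/Xsq rprim0//; have := FK t (ltW t0); lra.
by move=> u /andP[u0 _]; have := fF u u0; lra.
Qed.

Lemma sqdom_causal x B : causal x -> (forall t, Xsq x t <= B) -> sqdom x.
Proof. by move=> cx xB; exists (Xsq x), (fun t => x t * x t), B; split=> //; exact: XsqP. Qed.

Lemma sqdom_shift x d : causal x -> sqdom x -> sqdom (fun t => x (t - d)).
Proof.
move=> cx /(sqdom_Xsq cx)[B xB].
exists (fun t => Xsq x (t - d)), (fun t => x (t - d) * x (t - d)), B; split=> //.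
exact: rder_shift (XsqP cx _).
Qed.

Lemma delay_sqdom l d x f : 0 < l -> 0 <= d -> l * d < pi / 2 ->
  (forall t, t < 0 -> x t = 0) -> rder 0 x (fun t => - l * x (t - d) + f t) ->
  sqdom f -> sqdom x.
Proof.
move=> l0 d0 ld x0 xD [F [F' [K [FD fF FK]]]].
have [B xB] := delay_square_integrable l0 d0 ld x0 xD FD fF FK.
exact: sqdom_causal (rder_causal x0 xD) xB.
Qed.

(** A Barbalat argument. [x ^ 2 + P] is nondecreasing because [2 x x' + x ^ 2 + x' ^ 2] is a square,
    and [P] is bounded and nondecreasing. Once [P] is within [e ^ 2 / 2] of its supremum, a value
    [x s ^ 2 >= e ^ 2] would force [x ^ 2 >= e ^ 2 / 2] forever after. *)
Lemma sqdom_cvg0 x x' : causal x -> rder 0 x x' -> sqdom x -> sqdom x' -> x @ +oo --> 0.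
Proof.
move=> cx xD sx [G [G' [K [GD gG GK]]]]; have [B xB] := sqdom_Xsq cx sx.
pose P t := Xsq x t + G t.
have G'0 t : 0 <= t -> 0 <= G' t.
  by move=> /gG; apply: le_trans; rewrite -expr2 sqr_ge0.
have PD := rderD (XsqP cx 0) GD.
have x20 t : 0 <= x t * x t by rewrite -expr2 sqr_ge0.
have Pnd s t : 0 <= s <= t -> P s <= P t.
  move=> /andP[s0 st]; apply: rder_ge st (rder_weak s0 PD) _ => u /andP[su _].
  by apply: addr_ge0 => //; apply: G'0; exact: le_trans su.
have ePnd s t : 0 <= s <= t -> x s * x s + P s <= x t * x t + P t.
  move=> /andP[s0 st].
  apply: rder_ge st (rder_weak s0 (rderD (rderM xD xD) PD)) _ => u /andP[su _].
  have := gG u (le_trans s0 su); have := sqr_ge0 (x u + x' u); rewrite expr2; lra.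
pose E := [set P t | t in [set t | 0 <= t]].
have Esup : has_sup E.
  split; first by exists (P 0), 0 => //=; rewrite lexx.
  by exists (B + K) => _ [t /= t0 <-]; rewrite lerD ?GK.
apply/cvgrPdist_lt => e e0.
pose e2 := e ^+ 2 / 2; have e20 : 0 < e2 by rewrite divr_gt0 ?exprn_gt0.
have [_ [T /= T0 <-] PT] := sup_adherent e20 Esup.
have small s : T <= s -> x s * x s < e ^+ 2.
  move=> Ts; rewrite ltNge; apply/negP => xs.
  have s0 : 0 <= s := le_trans T0 Ts.
  have xge t : s <= t -> e2 <= x t * x t.
    move=> st; have t0 := le_trans s0 st.
    have Pt : P t <= sup E by apply: sup_upper_bound => //; exists t.
    have PsT : P T <= P s by apply: Pnd; rewrite T0.
    have := ePnd s t; rewrite s0 st => /(_ isT).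
    rewrite /e2 in PT *; lra.
  (* Long enough for [x ^ 2 >= e2] on [[s, t]] to make the integral of [x ^ 2] exceed its bound
     [B]. *)
  pose t := s + (B + 1) / e2.
  have B0 : 0 <= B by apply: le_trans (xB 0); exact: Xsq_ge0.
  have st : s <= t by rewrite lerDl divr_ge0 ?ltW// ltr_wpDl.
  lapply (rder_ge st (rderB (XsqP cx s) (rderZ e2 (rder_id s)))) => /=; last first.
    by move=> u /andP[su _]; have := xge u su; lra.
  have := xB t; have := Xsq_ge0 s cx.
  have : e2 * t = e2 * s + (B + 1) by rewrite /t mulrDr mulrCA divff ?mulr1// gt_eqF.
  lra.
near=> t; rewrite sub0r normrN.
rewrite -(@ltr_pXn2r _ 2)// ?nnegrE ?ltW// -normrX ger0_norm ?sqr_ge0//.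
rewrite [X in X < _]expr2; apply: small; near: t; apply: nbhs_pinfty_ge; exact: num_real.
Unshelve. all: by end_near. Qed.

End SquareDominated.

(** * Instability of the scalar equation at and beyond the threshold *)

Section Unstable.
Context {R : realType}.
Implicit Types (a d t r u l y : R) (x : R -> R).

Lemma rder_expRZ (c a : R) : rder a (fun t => expR (c * t)) (fun t => c * expR (c * t)).
Proof.
apply: rder_is_derive => t.
have H := @is_deriveZ _ _ _ id c t 1 1 (is_derive_id _ _).
apply: (is_derive_eq (@is_derive1_comp _ expR (c *: id) t _ _ (is_derive_expR _) H)).
by rewrite /GRing.scale/=; ring.
Qed.

Lemma sin_le y : 0 <= y -> sin y <= y.
Proof.
move=> y0; have H := rderB (rder_id (0 : R)) (rder_sinZ (1 : R) 0).
lapply (rder_ge y0 H); rewrite /= ?mulr0 ?mul1r ?sin0; first lra.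
by move=> t _; rewrite mul1r subr_ge0 cos_le1.
Qed.

(** The conclusion says that [s = al + i be] solves [s + l exp (- s d) = 0]. With [y = be d], the
    two real equations give [al d = - y cot y] and [l d = (y / sin y) exp (- y cot y)]. The latter
    is solved for [y] in [[pi / 2, pi)] by the intermediate value theorem; there [cos y <= 0],
    whence [0 <= al]. *)
Lemma unstable_root l d : 0 < l -> 0 <= d -> pi / 2 <= l * d ->
  exists al be, [/\ 0 <= al, l * (expR (- al * d) * cos (be * d)) = - al &
    l * (expR (- al * d) * sin (be * d)) = be].
Proof.
move=> l0 d0 ld; have pi0 := pi_gt0 R.
have d_gt0 : 0 < d.
  by rewrite lt_neqAle d0 andbT; apply: contraTneq ld => <-; rewrite mulr0 -ltNge; lra.
(* At the right end [y1 = pi - dl] one has [sin y1 = sin dl <= dl], so the function is at least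
   [(pi / 2) / dl = mu] there. *)
pose mu := l * d; pose dl : R := pi / 2 / mu.
have mu0 : 0 < mu by rewrite mulr_gt0.
have dl0 : 0 < dl by rewrite !divr_gt0.
have dl1 : dl <= 1 by rewrite /dl ler_pdivrMr// mul1r.
have pi2 : 2 <= pi :> R by exact: pi_ge2.
pose y1 : R := pi - dl.
have y1ge : pi / 2 <= y1 by rewrite /y1; lra.
pose f y := y / sin y * expR (- (y * cos y / sin y)).
have s0 y : pi / 2 <= y <= y1 -> 0 < sin y.
  by move=> yy; apply: sin_gt0_pi; rewrite /y1 in yy; lra.
have fc : {within `[pi / 2, y1], continuous f}.
  apply: continuous_in_subspaceT => y; rewrite inE/= in_itv/= => /s0 sy.
  have sc : {for y, continuous (fun y : R => (sin y)^-1)}.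
    by apply: continuousV; [rewrite gt_eqF|exact: continuous_sin].
  apply: (@continuousM _ _ (fun y => y / sin y) (fun y => expR (- (y * cos y / sin y)))).
    by apply: (@continuousM _ _ id (fun y => (sin y)^-1)); [exact: cvg_id|exact: sc].
  apply: (@continuous_comp _ _ _ (fun y => - (y * cos y / sin y)) expR); last exact: continuous_expR.
  apply: (@continuousN _ R _ (fun y => y * cos y / sin y)).
  apply: (@continuousM _ _ (fun y => y * cos y) (fun y => (sin y)^-1)); last exact: sc.
  by apply: (@continuousM _ _ id cos); [exact: cvg_id|exact: continuous_cos].
have fl : f (pi / 2) = pi / 2.
  by rewrite /f sin_pihalf cos_pihalf mulr0 mul0r oppr0 expR0 divr1 mulr1.
have fr : mu <= f y1.
  have sy : 0 < sin y1 by apply: s0; lra.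
  have sdl : sin y1 <= dl.
    by rewrite /y1 sinB sinpi cospi mul0r mulN1r sub0r opprK; exact: sin_le (ltW dl0).
  have cy : cos y1 <= 0.
    rewrite /y1 cosB cospi sinpi mul0r addr0 mulN1r oppr_le0.
    by apply: cos_ge0_pihalf; lra.
  have e1 : 1 <= expR (- (y1 * cos y1 / sin y1)).
    rewrite -expR0 ler_expR oppr_ge0 pmulr_lle0 ?invr_gt0// pmulr_rle0//; lra.
  apply: (@le_trans _ _ (y1 / sin y1)); last first.
    by rewrite /f ler_peMr// divr_ge0 ?ltW//; lra.
  rewrite ler_pdivlMr//; apply: (@le_trans _ _ (mu * dl)); first by rewrite ler_pM2l.
  by rewrite /dl mulrCA divff ?mulr1// gt_eqF.
have [|y yy fy] := IVT (v := mu) y1ge fc.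
  by rewrite fl ge_min ld/= le_max fr orbT.
rewrite in_itv/= in yy; have sy := s0 y yy.
have cy : cos y <= 0.
  rewrite -(subrK pi y) cosDpi oppr_le0 -cosN opprB.
  by apply: cos_ge0_pihalf; rewrite /y1 in yy; lra.
exists (- (y * cos y / sin y) / d), (y / d).
rewrite !divfK ?(gt_eqF d_gt0)//.
have -> : - (- (y * cos y / sin y) / d) * d = - - (y * cos y / sin y).
  by rewrite mulNr divfK// gt_eqF.
set g := - (y * cos y / sin y).
have key : l * expR (- g) = y / sin y / d.
  have eg0 : expR g != 0 by rewrite gt_eqF// expR_gt0.
  have fy' : y / sin y * expR g = l * d := fy.
  by rewrite expRN (canRL (mulfK eg0) fy'); field; rewrite eg0 gt_eqF.
split.
- rewrite divr_ge0// oppr_ge0 pmulr_lle0 ?invr_gt0// pmulr_rle0//; lra.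
- by rewrite mulrA key /g; field; rewrite !gt_eqF.
- by rewrite mulrA key; field; rewrite !gt_eqF.
Qed.

(** The modulus of [p + i q] below is nondecreasing since [0 <= al], and equals [|x 0|] at time 0,
    where the window integrals vanish. If [x] tended to 0, so would [p] and [q], which forces
    [x 0 = 0]. *)
Lemma delay_not_cvg0 l d x : 0 < l -> 0 <= d -> pi / 2 <= l * d ->
  (forall t, t < 0 -> x t = 0) -> rder 0 x (fun t => - l * x (t - d)) ->
  x @ +oo --> 0 -> x 0 = 0.
Proof.
move=> l0 d0 ld x0 xD xcv; have cx := rder_causal x0 xD.
have [al [be [al0 rc rs]]] := unstable_root l0 d0 ld.
pose kc u := expR (- al * u) * cos (be * u); pose ks u := expR (- al * u) * sin (be * u).
pose ec u := expR (al * u) * cos (be * u); pose es u := expR (al * u) * sin (be * u).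
have kcD a := rderM (rder_expRZ (- al) a) (rder_cosZ be a).
have ksD a := rderM (rder_expRZ (- al) a) (rder_sinZ be a).
have ecD a := rderM (rder_expRZ al a) (rder_cosZ be a).
have esD a := rderM (rder_expRZ al a) (rder_sinZ be a).
pose P := rprim (fun u => kc u * x u); pose Q := rprim (fun u => ks u * x u).
have PD a : rder a P (fun u => kc u * x u).
  by apply: rprimP; apply: causalMc cx; exact: rder_continuous kcD.
have QD a : rder a Q (fun u => ks u * x u).
  by apply: rprimP; apply: causalMc cx; exact: rder_continuous ksD.
have ekc u v : ec u * kc v + es u * ks v = expR (al * (u - v)) * cos (be * (u - v)).
  by rewrite mulrBr expRD mulrBr cosB /ec /es /kc /ks mulNr; ring.
have eks u v : es u * kc v - ec u * ks v = expR (al * (u - v)) * sin (be * (u - v)).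
  by rewrite mulrBr expRD mulrBr sinB /ec /es /kc /ks mulNr; ring.
(* [p + i q] is [x] minus [l] times the window integral of [exp (s * (t - u - d)) * x u] for
   the root [s = al + i be]; it satisfies [(p + i q)' = s (p + i q)]. *)
pose I1 t r := ec (t - d) * (P t - P r) + es (t - d) * (Q t - Q r).
pose I2 t r := es (t - d) * (P t - P r) - ec (t - d) * (Q t - Q r).
pose p t := x t - l * I1 t (t - d); pose q t := - l * I2 t (t - d).
have pD : rder 0 p (fun t => al * p t - be * q t).
  have H := rderB xD (rderZ l (rderD
    (rderM (rder_shift (ecD (0 - d))) (rderB (PD 0) (rder_shift (PD (0 - d)))))
    (rderM (rder_shift (esD (0 - d))) (rderB (QD 0) (rder_shift (QD (0 - d))))))).
  apply: rder_eq H => t _; rewrite /p /q /I1 /I2.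
  have := ekc (t - d) t; have := ekc (t - d) (t - d).
  have -> : t - d - t = - d by ring.
  rewrite subrr !mulr0 expR0 cos0 mulrN mulrN cosN -mulNr => A1 A2.
  rewrite -/(ec (t - d)) -/(es (t - d)).
  have -> : al * expR (al * (t - d)) * cos (be * (t - d)) = al * ec (t - d) by rewrite mulrA.
  move: rc; rewrite -A2 => {}A2; move: A1 A2.
  rewrite /ec /es; set E := expR (al * _); set c := cos (be * _); set s := sin (be * _).
  move: (P t) (P (t - d)) (Q t) (Q (t - d)) (x t) (x (t - d)) (kc t) (ks t) (kc (t - d))
    (ks (t - d)) => P0 P1 Q0 Q1 X Xd k0 s0 k1 s1 A1 A2.
  apply/eqP; rewrite -subr_eq0; apply/eqP.
  rewrite -[RHS](_ : X * (- al - l * (E * c * k0 + E * s * s0))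
     + l * Xd * (E * c * k1 + E * s * s1 - 1 * 1) = 0); last by rewrite A1 A2; ring.
  by ring.
have qD : rder 0 q (fun t => al * q t + be * p t).
  have H := rderZ (- l) (rderB
    (rderM (rder_shift (esD (0 - d))) (rderB (PD 0) (rder_shift (PD (0 - d)))))
    (rderM (rder_shift (ecD (0 - d))) (rderB (QD 0) (rder_shift (QD (0 - d)))))).
  apply: rder_eq H => t _; rewrite /p /q /I1 /I2.
  have := eks (t - d) t; have := eks (t - d) (t - d).
  have -> : t - d - t = - d by ring.
  rewrite subrr !mulr0 expR0 sin0 mulrN mulrN sinN -mulNr => A1 A2.
  have {}A2 := congr1 -%R A2; rewrite mulrN opprK in A2.
  move: rs; rewrite -A2 => {}A2; move: A1 A2.
  rewrite /ec /es; set E := expR (al * _); set c := cos (be * _); set s := sin (be * _).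
  move: (P t) (P (t - d)) (Q t) (Q (t - d)) (x t) (x (t - d)) (kc t) (ks t) (kc (t - d))
    (ks (t - d)) => P0 P1 Q0 Q1 X Xd k0 s0 k1 s1 A1 A2.
  apply/eqP; rewrite -subr_eq0; apply/eqP.
  rewrite -[RHS](_ : X * (l * - (E * s * k0 - E * c * s0) - be)
     + l * Xd * (E * s * k1 - E * c * s1 - 1 * 0) = 0); last by rewrite A1 A2; ring.
  by ring.
have Nge t : 0 <= t -> x 0 * x 0 <= p t * p t + q t * q t.
  move=> t0; have <- : p 0 * p 0 + q 0 * q 0 = x 0 * x 0.
    rewrite /p /q /I1 /I2 /P /Q !rprim0 ?sub0r ?oppr_le0//; ring.
  apply: rder_ge t0 (rderD (rderM pD pD) (rderM qD qD)) _ => u _.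
  have := mulr_ge0 al0 (sqr_ge0 (p u)); have := mulr_ge0 al0 (sqr_ge0 (q u)).
  rewrite !expr2; lra.
apply/eqP; apply/negPn/negP => x0n0.
(* If [|x| <= e] on a whole window, then [|p|] and [|q|] are at most [e (1 + l d) = |x 0| / 2], and
   [p ^ 2 + q ^ 2] is at most half of [x 0 ^ 2]. *)
pose e := `|x 0| / (2 * (1 + l * d)).
have ld0 : 0 < 1 + l * d by rewrite ltr_wpDr// mulr_ge0// ltW.
have e0 : 0 < e by rewrite divr_gt0 ?normr_gt0// mulr_gt0.
have [T [_ HT]] : \forall t \near +oo, `|x t| <= e.
  by move/cvgr0Pnorm_le : xcv; exact.
pose t := Num.max 0 T + 1 + d.
have t0 : 0 <= t by rewrite !addr_ge0// le_max lexx.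
have xe r : t - d <= r -> `|x r| <= e.
  move=> tr; apply: HT; apply: lt_le_trans tr.
  by rewrite /t addrK ltr_pwDr// le_max lexx orbT.
have td : t - d <= t by lra.
(* A window integral with kernel [w] bounded by 1 is at most [e d]: compare the derivative of [J]
   with [e] and [- e] and start from the empty window. *)
have bnd (J w : R -> R) : rder (t - d) J (fun r => - (w r * x r)) -> J t = 0 ->
    (forall r, t - d <= r -> `|w r| <= 1) -> `|J (t - d)| <= e * d.
  move=> JD Jt w1.
  have wx r : t - d <= r -> `|w r * x r| <= e.
    by move=> tr; rewrite normrM -[e]mul1r ler_pM ?w1 ?xe.
  rewrite ler_norml; apply/andP; split.
    lapply (rder_le td (rderB JD (rderZ e (rder_id (t - d))))) => /=; first by rewrite Jt; lra.
    by move=> r /andP[tr _]; have := wx r tr; rewrite ler_norml; lra.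
  lapply (rder_ge td (rderD JD (rderZ e (rder_id (t - d))))) => /=; first by rewrite Jt; lra.
  by move=> r /andP[tr _]; have := wx r tr; rewrite ler_norml; lra.
have wbnd (g : R -> R) : (forall u, `|g u| <= 1) ->
    forall r, t - d <= r -> `|expR (al * (t - d - r)) * g (be * (t - d - r))| <= 1.
  move=> g1 r tr; rewrite normrM -[leRHS]mul1r ler_pM//.
  rewrite ger0_norm ?expR_ge0// -expR0 ler_expR.
  by have := mulr_ge0 al0 (_ : 0 <= r - (t - d)); rewrite subr_ge0 => /(_ tr); lra.
have I1b : `|I1 t (t - d)| <= e * d.
  apply: (bnd (I1 t) (fun r => expR (al * (t - d - r)) * cos (be * (t - d - r)))).
  - have H := rderD (rderZ (ec (t - d)) (rderB (rder_cst (t - d) (P t)) (PD (t - d))))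
      (rderZ (es (t - d)) (rderB (rder_cst (t - d) (Q t)) (QD (t - d)))).
    by apply: rder_eq H => r _; rewrite -ekc; ring.
  - by rewrite /I1 !subrr; ring.
  - by apply: wbnd => u; rewrite ler_norml cos_geN1 cos_le1.
have I2b : `|I2 t (t - d)| <= e * d.
  apply: (bnd (I2 t) (fun r => expR (al * (t - d - r)) * sin (be * (t - d - r)))).
  - have H := rderB (rderZ (es (t - d)) (rderB (rder_cst (t - d) (P t)) (PD (t - d))))
      (rderZ (ec (t - d)) (rderB (rder_cst (t - d) (Q t)) (QD (t - d)))).
    by apply: rder_eq H => r _; rewrite -eks; ring.
  - by rewrite /I2 !subrr; ring.
  - by apply: wbnd => u; rewrite ler_norml sin_geN1 sin_le1.
have eE : e * (1 + l * d) = `|x 0| / 2 by rewrite /e; field; lra.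
have pb : `|p t| <= `|x 0| / 2.
  rewrite -eE /p (_ : e * (1 + l * d) = e + l * (e * d)); last by ring.
  apply: le_trans (ler_normB _ _) _; apply: lerD; first exact: xe.
  by rewrite normrM gtr0_norm// ler_pM2l.
have qb : `|q t| <= `|x 0| / 2.
  rewrite -eE /q (_ : e * (1 + l * d) = e + l * (e * d)); last by ring.
  apply: (@le_trans _ _ (l * (e * d))); last by rewrite lerDr ltW.
  rewrite mulNr normrN normrM (gtr0_norm l0).
  by rewrite ler_pM2l.
have sqb (v : R) : `|v| <= `|x 0| / 2 -> v * v <= x 0 * x 0 / 4.
  move=> vb; have sqn (w : R) : w * w = `|w| * `|w|.
    by rewrite -normrM ger0_norm// -expr2 sqr_ge0.
  rewrite (sqn v) (sqn (x 0)); have := ler_pM (normr_ge0 v) (normr_ge0 v) vb vb.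
  lra.
have := Nge t t0; have := sqb _ pb; have := sqb _ qb.
have : 0 < x 0 * x 0 by rewrite -expr2 lt_neqAle sqr_ge0 eq_sym sqrf_eq0 x0n0.
lra.
Qed.

End Unstable.

(** * Linear algebra of the hierarchy *)

Section Groups.
Implicit Types (k : nat -> nat -> nat) (i j : nat).

Lemma sum_ord_le (f : nat -> nat) p q : (p <= q)%N -> (\sum_(m < p) f m <= \sum_(m < q) f m)%N.
Proof.
by move=> pq; rewrite -(subnKC pq) big_split_ord /= leq_addr.
Qed.

Lemma inGroup_uniq k j i p q : inGroup k j i p -> inGroup k j i q -> p = q.
Proof.
wlog pq : p q / (p < q)%N => [H gp gq|].
  by have [pq|qp|//] := ltngtP p q; [exact: H|symmetry; exact: H].
move=> /andP[_ ip] /andP[qi _].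
by have := leq_trans ip (leq_trans (sum_ord_le (k j) pq) qi); rewrite ltnn.
Qed.

Lemma inGroup_ex k j i n : (i < \sum_(p < n) k j p)%N -> exists p : 'I_n, inGroup k j i p.
Proof.
elim: n => [|n IH] iN; first by rewrite big_ord0 in iN.
have [/IH[p pi]|ni] := ltnP i (\sum_(p < n) k j p).
  by exists (widen_ord (leqnSn n) p).
by exists ord_max; rewrite /inGroup ni.
Qed.

End Groups.

(** * The Laplacian and its Dirichlet form *)

Section Laplacian.
Context {R : realType}.

Lemma lapl_mul n q (B : 'M[R]_n) (X : 'M[R]_(n, q)) u i :
  (lapl B *m X) u i = \sum_v B u v * (X u i - X v i).
Proof.
rewrite /lapl mulmxBl mul_diag_mx !mxE mulr_suml -sumrB.
by apply: eq_bigr => v _; rewrite mulrBr.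
Qed.

(** Exchange the two summation indices and add the two expressions of the same sum. *)
Lemma lapl_quad n (B : 'M[R]_n) (y : 'cV[R]_n) : (forall u v, B u v = B v u) ->
  2 * (y^T *m (lapl B *m y)) 0 0 = \sum_u \sum_v B u v * (y u 0 - y v 0) ^+ 2.
Proof.
move=> Bsym; rewrite mxE (eq_bigr (fun u => \sum_v B u v * (y u 0 * (y u 0 - y v 0)))); last first.
  by move=> u _; rewrite lapl_mul !mxE mulr_sumr; apply: eq_bigr => v _; ring.
pose s : R := \sum_u \sum_v B u v * (y u 0 * (y u 0 - y v 0)); rewrite -/s.
have sE : s = \sum_u \sum_v B u v * (y v 0 * (y v 0 - y u 0)).
  rewrite /s exchange_big /=; apply: eq_bigr => u _; apply: eq_bigr => v _.
  by rewrite (Bsym v u).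
have -> : 2 * s = s + s by ring.
rewrite {2}sE /s -big_split; apply: eq_bigr => u _; rewrite -big_split; apply: eq_bigr => v _ /=.
by ring.
Qed.

End Laplacian.

(** * Products, kernels and row spaces of the layer matrices *)

Section Hierarchy.
Context {R : realType} (M : nat) (N : nat -> nat) (k : nat -> nat -> nat)
  (A : forall j, 'M[R]_(N j)) (a : 'I_(N 0%N) -> R) (C : forall j, 'M[R]_(N j.+1, N j))
  (HS : hier_struct M N k) (HG : graph_struct M N k A) (a_gt0 : forall i, 0 < a i)
  (HC : C_struct N k M C).

Local Notation B := (@Bmx R N k).
Local Notation Bp := (@Bprod R N k).
Local Notation Cp := (Cprod N C).
Local Notation L := (Lmat N k A a C).
Local Notation aw := (aw N k a).

Definition Smat j := Kmx N k a j *m lapl (A j).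

Lemma LmatE j : L j = Bp j *m Smat j *m Cp j.
Proof. by []. Qed.

Lemma group_of j (u : 'I_(N j)) : (j < M)%N -> exists p : 'I_(N j.+1), inGroup k j u p.
Proof.
move=> jM; apply: inGroup_ex.
by have [_ _ _ H] := HS; rewrite -H.
Qed.

Lemma group_nonempty j (p : 'I_(N j.+1)) : (j < M)%N -> exists u : 'I_(N j), inGroup k j u p.
Proof.
move=> jM; have [_ _ k0 NE] := HS.
have lt : (\sum_(m < p) k j m < \sum_(m < p.+1) k j m)%N.
  by rewrite big_ord_recr/= -[X in (X < _)%N]addn0 ltn_add2l k0.
have ltN : (\sum_(m < p) k j m < N j)%N.
  by rewrite (NE j jM) (leq_trans lt)// sum_ord_le.
by exists (Ordinal ltN); rewrite /inGroup /= leqnn.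
Qed.

Lemma aw_gt0 j : (j <= M)%N -> forall i, 0 < aw j i.
Proof.
elim: j => [|j IH] jM i; first exact: a_gt0.
have [u ui] := group_nonempty i jM.
have IH' := IH (ltnW jM).
rewrite /= (bigD1 u)//=; apply: ltr_pwDl; first exact: IH'.
by apply: sumr_ge0 => v _; apply: ltW; exact: IH'.
Qed.

Lemma KmxE j : (j <= M)%N -> Kmx N k a j = diag_mx (\row_i (aw j i)^-1).
Proof.
move=> jM; have H : diag_mx (\row_i (aw j i)^-1) *m diag_mx (\row_i aw j i) = 1%:M.
  rewrite mulmx_diag; apply/matrixP => u v; rewrite !mxE.
  by rewrite mulVf// gt_eqF// aw_gt0.
have [_ U] := mulmx1_unit H.
by rewrite /Kmx -[RHS]mulmx1 -(mulmxV U) mulmxA H mul1mx.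
Qed.

(** Edges stay inside groups, so the indicator of a group takes equal values at the two ends of each
    edge. *)
Lemma lapl_B j : (j < M)%N -> lapl (A j) *m B j = 0.
Proof.
move=> jM; apply/matrixP => u p; rewrite lapl_mul [RHS]mxE big1// => v _.
have [_ sym inG _] := HG jM; rewrite !mxE.
have [->|Auv] := eqVneq (A j u v) 0; first by rewrite mul0r.
suff -> : inGroup k j u p = inGroup k j v p by rewrite subrr mulr0.
by apply/idP/idP => H; [exact: inG H Auv|apply: inG H _; rewrite -sym].
Qed.

Lemma Smat_B j : (j < M)%N -> Smat j *m B j = 0.
Proof. by move=> jM; rewrite /Smat -mulmxA lapl_B// mulmx0. Qed.

(** The Dirichlet form of each column vanishes, so the column is constant along edges and, by
    connectedness, on every group. [Z] reads off the value at a chosen representative of each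
    group. *)
Lemma lapl_ker j q (Y : 'M[R]_(N j, q)) : (j < M)%N -> lapl (A j) *m Y = 0 ->
  exists Z, Y = B j *m Z.
Proof.
move=> jM LY; have [A01 sym inG conn] := HG jM.
have Aeq u v i : A j u v != 0 -> Y u i = Y v i.
  move=> Auv; pose y := col i Y.
  have Ly0 : lapl (A j) *m y = 0 by rewrite /y colE mulmxA LY mul0mx.
  have := lapl_quad y sym; rewrite Ly0 mulmx0 mxE mulr0 => /esym H.
  have A0 w z : 0 <= A j w z by case: (A01 w z) => ->.
  have T0 w z : 0 <= A j w z * (y w 0 - y z 0) ^+ 2 by rewrite mulr_ge0 ?sqr_ge0.
  have /(_ u isT)/eqP := psumr_eq0P (fun w _ => sumr_ge0 _ (fun z _ => T0 w z)) H.
  rewrite psumr_eq0// => /allP/(_ v); rewrite mem_index_enum => /(_ isT).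
  by rewrite /= mulf_eq0 (negbTE Auv)/= sqrf_eq0 subr_eq0 !mxE => /eqP.
have Ycon u v i : connect (fun x y => A j x y != 0) u v -> Y u i = Y v i.
  move=> /connectP[s + ->]; elim: s u => [//|w s IH] u /= /andP[uw /IH <-].
  exact: Aeq.
have /choice[rep repP] p := group_nonempty p jM.
exists (\matrix_(p, i) Y (rep p) i); apply/matrixP => u i.
have [p up] := group_of u jM.
rewrite mxE (bigD1 p)//= big1 ?addr0 => [|p' p'p]; rewrite !mxE.
  by rewrite up mul1r; apply: Ycon; exact: conn up (repP p).
case: (boolP (inGroup k j u p')) => [up'|_]; last by rewrite mul0r.
by case/eqP: p'p; apply/val_inj; exact: inGroup_uniq up' up.
Qed.

Lemma C_B j : (j.+1 < M)%N -> C j *m B j = 1%:M.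
Proof.
move=> jM; have [C0 Cin C1] := HC jM; apply/matrixP => p q; rewrite !mxE.
have [->|pq] := eqVneq p q.
  rewrite -[RHS](C1 q); apply: eq_bigr => i _; rewrite mxE.
  by case: (boolP (inGroup k j i q)) => H; rewrite ?mulr1// Cin// mul0r.
rewrite big1// => i _; rewrite mxE.
case: (boolP (inGroup k j i q)) => H; last by rewrite mulr0.
rewrite Cin ?mul0r//; apply: contraNN pq => H'.
by apply/eqP/val_inj; exact: inGroup_uniq H' H.
Qed.

Lemma Cp_Bp j : (j < M)%N -> Cp j *m Bp j = 1%:M.
Proof.
elim: j => [|j IH] jM; first by rewrite /= mulmx1.
rewrite /= -mulmxA (mulmxA (Cp j)) IH ?mul1mx ?C_B//.
exact: ltnW.
Qed.

Lemma Bp_split i j : (i <= j)%N -> exists D, Bp j = Bp i *m D.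
Proof.
move=> /subnKC <-; elim: (j - i)%N => [|m [D E]].
  by rewrite addn0; exists 1%:M; rewrite mulmx1.
by rewrite addnS /= E; exists (D *m B (i + m)); rewrite mulmxA.
Qed.

Lemma Bp_Cp_Bp i j : (i < M)%N -> (i <= j)%N -> Bp i *m Cp i *m Bp j = Bp j.
Proof.
by move=> iM /Bp_split[D ->]; rewrite mulmxA -(mulmxA (Bp i)) Cp_Bp// mulmx1.
Qed.

(** [Bp j] factors through [Bp i.+1 = Bp i *m B i]; the factor [Cp i] cancels [Bp i], and [Smat i]
    kills [B i]. *)
Lemma Smat_Cp_Bp i j : (i < M)%N -> (i < j)%N -> Smat i *m Cp i *m Bp j = 0.
Proof.
move=> iM /Bp_split[D ->]; rewrite /= !mulmxA -(mulmxA (Smat i)) Cp_Bp// mulmx1.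
by rewrite Smat_B// mul0mx.
Qed.

Lemma Lmat_Bp i j : (i < M)%N -> (i < j)%N -> L i *m Bp j = 0.
Proof. by move=> iM ij; rewrite LmatE -[_ *m _ *m Cp i]mulmxA -mulmxA Smat_Cp_Bp// mulmx0. Qed.

Lemma Lmat_mul0 i j : (i < M)%N -> (i < j)%N -> L i *m L j = 0.
Proof. by move=> iM ij; rewrite (LmatE j) !mulmxA Lmat_Bp// !mul0mx. Qed.

Lemma Bp_ones j : (j <= M)%N -> Bp j *m const_mx 1 = const_mx 1 :> 'cV[R]_(N 0).
Proof.
elim: j => [|j IH] jM; first by rewrite /= mul1mx.
rewrite /= -mulmxA -[RHS](IH (ltnW jM)); congr (_ *m _).
apply/matrixP => u q; rewrite !mxE.
have [p up] := group_of u jM.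
rewrite (bigD1 p)//= big1 ?addr0 => [|p' p'p]; rewrite !mxE mulr1 ?up//.
case: (boolP (inGroup k j u p')) => // up'.
by case/eqP: p'p; apply/val_inj; exact: inGroup_uniq up' up.
Qed.

Lemma Lmat_ones j : (j < M)%N -> L j *m const_mx 1 = 0 :> 'cV[R]_(N 0).
Proof. by move=> jM; rewrite -(Bp_ones (leqnn M)) mulmxA Lmat_Bp// mul0mx. Qed.

Lemma N0_gt0 : (0 < N 0)%N.
Proof.
have [_ NM _ _] := HS.
suff H j : (j <= M)%N -> (0 < N (M - j))%N by have := H M (leqnn M); rewrite subnn.
elim: j => [|j IH] jM; first by rewrite subn0 NM.
have jM' : (M - j.+1 < M)%N by rewrite ltn_subrL/=; case: (M) jM.
have H : (0 < N (M - j.+1).+1)%N by rewrite subnSK// IH// ltnW.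
have [u _] := group_nonempty (Ordinal H) jM'.
exact: leq_ltn_trans (leq0n u) (ltn_ord u).
Qed.

Lemma arow_Bp j : (\row_i a i) *m Bp j = \row_i aw j i.
Proof.
elim: j => [|j IH]; first by rewrite /= mulmx1.
rewrite /= mulmxA IH; apply/rowP => p; rewrite !mxE [RHS]big_mkcond/=.
by apply: eq_bigr => i _; rewrite !mxE; case: ifP; rewrite ?mulr1 ?mulr0.
Qed.

(** Aggregation by [Bp j] turns the weights into those of layer [j], which cancel [Kmx] and leave
    the all-ones row, a left null vector of the symmetric Laplacian. This yields the conserved
    quantity of the dynamics. *)
Lemma arow_Lmat j : (j < M)%N -> (\row_i a i) *m L j = 0.
Proof.
move=> jM; rewrite LmatE !mulmxA arow_Bp (KmxE (ltnW jM)).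
have -> : \row_i aw j i *m diag_mx (\row_i (aw j i)^-1) = const_mx 1.
  by apply/rowP => i; rewrite mul_mx_diag !mxE divff// gt_eqF// (aw_gt0 (ltnW jM)).
suff -> : (const_mx 1 : 'rV[R]_(N j)) *m lapl (A j) = 0 by rewrite mul0mx.
have [_ sym _ _] := HG jM.
apply/rowP => v; rewrite /lapl mulmxBr mul_mx_diag !mxE mul1r.
apply/eqP; rewrite subr_eq0; apply/eqP/eq_bigr => u _.
by rewrite mxE mul1r sym.
Qed.

(** Climb the layers: if [Y = Bp j *m Z], then applying [Cp j] to [L j *m Y = 0] leaves
    [Smat j *m Z = 0], and [lapl_ker] extracts one more factor [B j] from [Z]. *)
Lemma Lmat_joint_ker q (Y : 'M[R]_(N 0, q)) : (forall j, (j < M)%N -> L j *m Y = 0) ->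
  exists Z, Y = Bp M *m Z.
Proof.
move=> LY; suff H j : (j <= M)%N -> exists Z, Y = Bp j *m Z by exact: H.
elim: j => [|j IH] jM; first by exists Y; rewrite /= mul1mx.
have [Z YZ] := IH (ltnW jM).
have : Cp j *m (L j *m Y) = 0 by rewrite LY// mulmx0.
rewrite LmatE YZ !mulmxA Cp_Bp// mul1mx -(mulmxA (Smat j)) Cp_Bp// mulmx1 => SZ.
have [|Z' ->] := @lapl_ker j _ Z jM; last by exists Z'; rewrite mulmxA.
(* Multiplying by the weights undoes [Kmx] and leaves the bare Laplacian. *)
have : diag_mx (\row_i aw j i) *m (Smat j *m Z) = 0 by rewrite SZ mulmx0.
rewrite /Smat (KmxE (ltnW jM)) !mulmxA mulmx_diag => <-.
rewrite (_ : diag_mx _ = 1%:M) ?mul1mx//.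
by apply/matrixP => u v; rewrite !mxE divff// gt_eqF// (aw_gt0 (ltnW jM)).
Qed.

(** Duality: the cokernel of the sum of the row spaces is killed by every [L j], hence factors
    through [Bp M]. As [N M = 1], that matrix is the single all-ones column, which [r]
    annihilates. *)
Lemma row_sum_Lmat (r : 'rV[R]_(N 0)) : r *m const_mx 1 = 0 :> 'cV[R]_1 ->
  exists q : 'I_M -> 'rV[R]_(N 0), r = \sum_j q j *m L j.
Proof.
move=> r1; suff : (r <= \sum_(j < M) L j)%MS.
  move=> /sub_sumsmxP[q ->]; exists q; exact: eq_bigr.
set X := (\sum_(j < M) L j)%MS.
have [Z cZ] : exists Z, cokermx X = Bp M *m Z.
  apply: Lmat_joint_ker => j jM; apply/eqP.
  by rewrite -submxE; exact: (sumsmx_sup (Ordinal jM)).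
have [_ NM _ _] := HS; rewrite submxE cZ mulmxA.
suff -> : r *m Bp M = 0 by rewrite mul0mx.
apply/rowP => p; have := congr1 (fun Y : 'cV[R]_1 => Y 0 0) r1.
rewrite -(Bp_ones (leqnn M)) mulmxA [LHS]mxE [RHS]mxE => H; rewrite [RHS]mxE -[RHS]H.
rewrite (bigD1 p)//= big1 ?addr0 => [|p' p'p]; first by rewrite [const_mx _ _ _]mxE mulr1.
case/eqP: p'p; apply/val_inj.
by case: p p' {H} => [p +] [p' +] /=; rewrite NM !ltnS !leqn0 => /eqP -> /eqP ->.
Qed.

End Hierarchy.

(** * Decomposition into real eigenvectors *)

Section RealSpectral.
Context {R : realType}.
Local Open Scope complex_scope.

Lemma Re_sum (I : Type) (s : seq I) (F : I -> R[i]) :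
  complex.Re (\sum_(i <- s) F i) = \sum_(i <- s) complex.Re (F i).
Proof.
elim: s => [|i s IH]; first by rewrite !big_nil.
by rewrite !big_cons -IH; case: (F i) (\sum_(j <- s) F j) => [x y] [u v].
Qed.

Lemma Re_mulC (z : R[i]) (r : R) : complex.Re (z * r%:C) = complex.Re z * r.
Proof. by case: z => x y /=; rewrite mulr0 subr0. Qed.

Lemma realC (r : R) : r%:C \is Num.real.
Proof. by rewrite realE !lecR; exact: num_real. Qed.

(* Real parts of complex eigenvectors for a real eigenvalue are eigenvectors, so the
   complex spectral theorem decomposes real rows into real eigenvectors. *)
Lemma sym_eigenrow_ind n (T : 'M[R]_n) (G : 'rV[R]_n -> Prop) : T^T = T ->
  G 0 -> (forall u v, G u -> G v -> G (u + v)) ->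
  (forall r l, r *m T = l *: r -> G r) -> forall q, G q.
Proof.
move=> Tsym G0 GD Geig q.
have Th : toC T \is hermsymmx.
  apply: realsym_hermsym.
    apply/is_hermitianmxP; rewrite expr0 scale1r; apply/matrixP => u v.
    by rewrite !mxE -{1}Tsym mxE.
  by apply/mxOverP => i j; rewrite mxE realC.
pose P := spectralmx (toC T); pose sp := spectral_diag (toC T).
have Pu : P \in unitmx by exact: spectral_unit.
have PT : P *m toC T = diag_mx sp *m P.
  have /orthomx_spectralP E := hermitian_normalmx Th.
  by rewrite {1}E !mulmxA mulmxV// mul1mx.
have spr p : (complex.Re (sp 0 p))%:C = sp 0 p.
  by apply: RRe_real; have /mxOverP := hermitian_spectral_diag_real Th; exact.
pose c := toC q *m invmx P.
have qE : toC q = \sum_p c 0 p *: row p P.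
  by rewrite -[LHS]mulmx1 -(mulVmx Pu) mulmxA mulmx_sum_row.
move: c qE => c qE.
pose r p : 'rV[R]_n := \row_i complex.Re (c 0 p * P p i).
have -> : q = \sum_p r p.
  apply/rowP => i; have := congr1 (fun Y : 'rV[R[i]]_n => complex.Re (Y 0 i)) qE.
  rewrite mxE /= summxE Re_sum summxE => ->; apply: eq_bigr => p _.
  by rewrite !mxE.
apply: (big_ind G) => // p _; apply: (Geig _ (complex.Re (sp 0 p))).
apply/rowP => i; rewrite !mxE.
have := congr1 (fun Y : 'M[R[i]]_n => complex.Re (c 0 p * Y p i)) PT.
rewrite mul_diag_mx !mxE mulr_sumr Re_sum -(spr p) => H.
rewrite [RHS](_ : _ = complex.Re (c 0 p * ((complex.Re (sp 0 p))%:C * P p i))); last first.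
  have -> : c 0 p * ((complex.Re (sp 0 p))%:C * P p i) =
      (c 0 p * P p i) * (complex.Re (sp 0 p))%:C by rewrite mulrCA mulrC.
  by rewrite Re_mulC mulrC.
rewrite -H; apply: eq_bigr => u _; rewrite !mxE mulrA Re_mulC//.
Qed.

(** With [D] the square root of the weights and [E] its inverse, [E *m E *m B] is similar to the
    symmetric [E *m B *m E]; a row eigenvector [r] of the latter gives [r *m D] for the former. *)
Lemma weighted_eigenrow_ind n (w : 'I_n -> R) (B : 'M[R]_n) (G : 'rV[R]_n -> Prop) :
  (forall i, 0 < w i) -> B^T = B ->
  G 0 -> (forall u v, G u -> G v -> G (u + v)) ->
  (forall r l, r *m (diag_mx (\row_i (w i)^-1) *m B) = l *: r -> G r) -> forall q, G q.
Proof.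
move=> w0 Bsym G0 GD Geig q.
pose D : 'M[R]_n := diag_mx (\row_i Num.sqrt (w i)).
pose E : 'M[R]_n := diag_mx (\row_i (Num.sqrt (w i))^-1).
have sw i : Num.sqrt (w i) != 0 by rewrite sqrtr_eq0 -ltNge.
have DE : D *m E = 1%:M.
  by rewrite mulmx_diag; apply/matrixP => i j; rewrite !mxE divff.
have ED : E *m D = 1%:M.
  by rewrite mulmx_diag; apply/matrixP => i j; rewrite !mxE mulVf.
have EE : E *m E = diag_mx (\row_i (w i)^-1).
  by rewrite mulmx_diag; congr diag_mx; apply/rowP => i; rewrite !mxE -invfM -expr2 sqr_sqrtr// ltW.
have -> : q = (q *m E) *m D by rewrite -mulmxA ED mulmx1.
apply: (@sym_eigenrow_ind n (E *m B *m E) (fun r => G (r *m D))).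
- by rewrite !trmx_mul tr_diag_mx Bsym mulmxA.
- by rewrite mul0mx.
- by move=> u v; rewrite mulmxDl; exact: GD.
- move=> r l rE; apply: (Geig _ l); rewrite -EE !mulmxA -(mulmxA r) DE mulmx1.
  by rewrite -[LHS]mulmx1 -ED mulmxA -!(mulmxA r) (mulmxA r) rE scalemxAl.
Qed.

(** The real eigenvalues are the finitely many real roots of the characteristic polynomial. A
    maximal one is needed to make use of a condition phrased with [is_max_eig]. *)
Lemma eigenvalue_max n (T : 'M[R]_n) l : eigenvalue T l ->
  exists m, is_max_eig T m.
Proof.
move=> Tl; pose s := rootsR (char_poly T).
have sE m : eigenvalue T m = (m \in s).
  rewrite eigenvalue_root_char.
  have /roots_on_rootsR/(_ m) : char_poly T != 0 by rewrite monic_neq0// char_poly_monic.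
  by rewrite in_itv.
have ls : l \in s by rewrite -sE.
pose f (i : 'I_(size s)) := nth 0 s i.
have i0 : (index l s < size s)%N by rewrite index_mem.
pose i := [arg max_(i > Ordinal i0) f i]%O.
exists (f i); split; first by rewrite sE mem_nth.
move=> m; rewrite sE => ms; rewrite /i; case: arg_maxP => // i1 _ Hmax.
have im : (index m s < size s)%N by rewrite index_mem.
by have := Hmax (Ordinal im) isT; rewrite /f /= nth_index.
Qed.

End RealSpectral.

(** * Spectra of the layer matrices *)

Section HierarchySpectral.
Context {R : realType} (M : nat) (N : nat -> nat) (k : nat -> nat -> nat)
  (A : forall j, 'M[R]_(N j)) (a : 'I_(N 0%N) -> R) (C : forall j, 'M[R]_(N j.+1, N j))
  (HS : hier_struct M N k) (HG : graph_struct M N k A) (a_gt0 : forall i, 0 < a i)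
  (HC : C_struct N k M C).

Local Notation B := (@Bmx R N k).
Local Notation Bp := (@Bprod R N k).
Local Notation Cp := (Cprod N C).
Local Notation L := (Lmat N k A a C).
Local Notation aw := (aw N k a).
Local Notation S := (Smat k A a).

Lemma lapl_sym j : (j < M)%N -> (lapl (A j))^T = lapl (A j).
Proof.
move=> jM; have [_ sym _ _] := HG jM; rewrite /lapl linearB/= tr_diag_mx; congr (_ - _).
by apply/matrixP => u v; rewrite mxE sym.
Qed.

Lemma Smat_eigenrow_ind j (G : 'rV[R]_(N j) -> Prop) : (j < M)%N ->
  G 0 -> (forall u v, G u -> G v -> G (u + v)) ->
  (forall r l, r *m S j = l *: r -> G r) -> forall q, G q.
Proof.
move=> jM G0 GD Geig; apply: (weighted_eigenrow_ind (aw_gt0 HS a_gt0 (ltnW jM)) (lapl_sym jM)) => //.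
move=> r l; rewrite -(KmxE HS a_gt0 (ltnW jM)); exact: Geig.
Qed.

(** At [y = K r^T] the Dirichlet form equals [l] times the positive sum of the [r_i ^ 2 / aw_i]. *)
Lemma Smat_eig_ge0 j (r : 'rV_(N j)) l : (j < M)%N -> r *m S j = l *: r -> r != 0 -> 0 <= l.
Proof.
move=> jM rS r0; have aw0 := aw_gt0 HS a_gt0 (ltnW jM).
pose y := (r *m Kmx N k a j)^T.
have [A01 sym _ _] := HG jM.
have yLy : (y^T *m (lapl (A j) *m y)) 0 0 = l * \sum_i r 0 i ^+ 2 / aw j i.
  rewrite mulmxA trmxK -(mulmxA r) -/(S j) rS -scalemxAl mxE; congr (_ * _).
  rewrite mxE; apply: eq_bigr => i _; rewrite mxE (KmxE HS a_gt0 (ltnW jM)).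
  by rewrite mul_mx_diag !mxE mulrA -expr2.
have s0 : 0 < \sum_i r 0 i ^+ 2 / aw j i.
  have [i ri] : exists i, r 0 i != 0.
    by move/rV0Pn : r0.
  rewrite (bigD1 i)//=; apply: ltr_pwDl.
    by rewrite divr_gt0// lt_neqAle sqr_ge0 eq_sym sqrf_eq0 ri.
  by apply: sumr_ge0 => u _; apply: divr_ge0; [exact: sqr_ge0|exact: ltW].
have := lapl_quad y sym; rewrite yLy => E.
rewrite -(pmulr_lge0 _ s0) -(@pmulr_rge0 _ 2)// E.
apply: sumr_ge0 => u _; apply: sumr_ge0 => v _; apply: mulr_ge0; last exact: sqr_ge0.
by case: (A01 u v) => ->.
Qed.

(** Right multiplication by [Cp j] carries row eigenvectors of [S j] to those of [L j], injectively
    because [Cp j *m Bp j = 1]. For nonzero eigenvalues [Bp j] carries them back, as the next lemma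
    shows. *)
Lemma Lmat_eigenvalue j (r : 'rV_(N j)) l : (j < M)%N -> r *m S j = l *: r -> r != 0 -> eigenvalue (L j) l.
Proof.
move=> jM rS r0; apply/eigenvalueP; exists (r *m Cp j).
  rewrite LmatE !mulmxA -(mulmxA r) (Cp_Bp HC jM) mulmx1.
  by rewrite -(mulmxA r) -/(S j) rS scalemxAl.
apply: contraNneq r0 => rC0; apply/eqP.
by rewrite -[r]mulmx1 -(Cp_Bp HC jM) mulmxA rC0 mul0mx.
Qed.

Lemma eigenvalue_Lmat j l : (j < M)%N -> eigenvalue (L j) l -> l != 0 ->
  exists2 r : 'rV_(N j), r *m S j = l *: r & r != 0.
Proof.
move=> jM /eigenvalueP[q qL q0] l0; exists (q *m Bp j).
  by rewrite scalemxAl -qL LmatE !mulmxA -[RHS]mulmxA (Cp_Bp HC jM) mulmx1.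
apply: contraNneq q0 => qB0; move: qL; rewrite LmatE !mulmxA qB0 !mul0mx => /esym/eqP.
by rewrite scaler_eq0 (negbTE l0).
Qed.

End HierarchySpectral.

(** * The characteristic equation *)

Section Characteristic.
Context {R : realType}.
Local Open Scope complex_scope.

Lemma cexp0 : cexp 0 = 1 :> R[i].
Proof. by rewrite /cexp /= cos0 sin0 expR0 mul1r. Qed.

Lemma cexpNK (z : R[i]) : cexp z * cexp (- z) = 1.
Proof.
case: z => u v; rewrite /cexp /= cosN sinN mulrACA -rmorphM/= -expRD subrr expR0 mul1r.
apply/eqP; rewrite eq_complex /=; apply/andP; split; apply/eqP.
  by rewrite mulrN opprK -!expr2 cos2Dsin2.
by ring.
Qed.

(** Since the partial sum [T] satisfies [T *m X m = 0], one has
    [s (s + T + X m) = (s + T) (s + X m)]; take determinants and induct. *)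
Lemma det_triangular_eq0 (F : fieldType) n m (X : nat -> 'M[F]_n) (s : F) : s != 0 ->
  (forall i j, (i < j < m)%N -> X i *m X j = 0) ->
  \det (s%:M + \sum_(0 <= j < m) X j) = 0 <->
  exists2 j, (j < m)%N & \det (s%:M + X j) = 0.
Proof.
move=> s0; elim: m => [_|m IH X0].
  rewrite big_geq// addr0 det_scalar; split=> [/eqP|[]//].
  by rewrite expf_eq0 (negbTE s0) andbF.
have {IH} /IH IH : forall i j, (i < j < m)%N -> X i *m X j = 0.
  by move=> i j /andP[ij jm]; rewrite X0// ij ltnW.
rewrite big_nat_recr//=; set T := \sum_(0 <= j < m) X j in IH *.
have TX : T *m X m = 0.
  by rewrite mulmx_suml big_nat_cond big1// => i /andP[/andP[_ im] _]; rewrite X0// im/=.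
have E : s *: (s%:M + (T + X m)) = (s%:M + T) *m (s%:M + X m).
  rewrite mulmxDr [_ *m X m]mulmxDl TX addr0 mul_mx_scalar mul_scalar_mx.
  by rewrite -scalerDr addrA.
have D : (\det (s%:M + (T + X m)) = 0) <->
    (\det (s%:M + T) = 0 \/ \det (s%:M + X m) = 0).
  have := congr1 determinant E; rewrite detZ det_mulmx => {}E.
  have sn : s ^+ n != 0 by rewrite expf_neq0.
  split=> [d0|d0].
    move: E; rewrite d0 mulr0 => /esym/eqP; rewrite mulf_eq0.
    by move=> /orP[] /eqP ->; [left|right].
  apply: (mulfI sn); rewrite mulr0 E.
  by case: d0 => ->; rewrite ?mul0r ?mulr0.
rewrite D IH; split=> [[[j jm Xj]|Xm]|[j]].
- by exists j => //; rewrite ltnW.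
- by exists m.
- by rewrite ltnS leq_eqVlt => /predU1P[->|jm] Xj; [right|left; exists j].
Qed.

Lemma det_shift_eigenvalue (F : fieldType) n (X : 'M[F]_n) (s c : F) : c != 0 ->
  \det (s%:M + c *: X) = 0 <-> eigenvalue X (- (s / c)).
Proof.
move=> c0; split=> [/eqP/det0P[v v0 vE]|/eigenvalueP[v vE v0]].
  apply/eigenvalueP; exists v => //; move: vE.
  rewrite mulmxDr mul_mx_scalar -scalemxAr => /eqP.
  rewrite addrC addr_eq0 => /eqP H.
  by rewrite -[LHS]scale1r -(mulVf c0) -scalerA H scalerN scalerA scaleNr mulrC.
apply/eqP/det0P; exists v => //.
rewrite mulmxDr mul_mx_scalar -scalemxAr vE scalerA mulrN mulrC divfK//.
by rewrite scaleNr subrr.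
Qed.

Context (M : nat) (N : nat -> nat) (k : nat -> nat -> nat)
  (A : forall j, 'M[R]_(N j)) (a : 'I_(N 0%N) -> R) (C : forall j, 'M[R]_(N j.+1, N j))
  (tau : nat -> R)
  (HS : hier_struct M N k) (HG : graph_struct M N k A) (a_gt0 : forall i, 0 < a i)
  (HC : C_struct N k M C).

Local Notation L := (Lmat N k A a C).

Lemma toCM m n p (X : 'M[R]_(m, n)) (Y : 'M[R]_(n, p)) : toC (X *m Y) = toC X *m toC Y.
Proof. by rewrite /toC -[map_mx _ (X *m Y)]/(map_mx (real_complex R) _) map_mxM. Qed.

Lemma characteristic_roots (s : R[i]) :
  \det (s%:M + toC (L 0%N)
        + \sum_(1 <= j < M) cexp (- (2%:R * s * (cum tau j)%:C)) *: toC (L j)) = 0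
  <->
  [\/ s = 0,
      exists lam, [/\ ceig (L 0%N) lam, lam != 0 & s + lam = 0] |
      exists j, (1 <= j < M)%N /\
        exists lam, [/\ ceig (L j) lam, lam != 0 &
                        s * cexp (2%:R * s * (cum tau j)%:C) + lam = 0]].
Proof.
have [M2 _ _ _] := HS; have M0 : (0 < M)%N by exact: leq_trans M2.
pose e j := 2%:R * s * (cum tau j)%:C.
pose c j := cexp (- e j).
have e0 : e 0%N = 0 by rewrite /e /cum big_ord0 mulr0.
have -> : s%:M + toC (L 0%N) + \sum_(1 <= j < M) c j *: toC (L j) =
    s%:M + \sum_(0 <= j < M) c j *: toC (L j).
  by rewrite [in RHS]big_ltn// /c e0 oppr0 cexp0 scale1r addrA.
have [->|s0] := eqVneq s 0.
  split=> _; first by constructor.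
  (* At [s = 0] the all-ones vector is a right null vector of every summand, whereas [det0P] asks
     for a left one; hence the transpose. *)
  apply/eqP; rewrite -det_tr; apply/det0P; exists (const_mx 1).
    apply/rV0Pn; exists (Ordinal (N0_gt0 HS)); by rewrite mxE oner_eq0.
  apply: (can_inj trmxK); rewrite trmx_mul trmxK trmx0 trmx_const.
  rewrite mulmxDl mul_scalar_mx scale0r add0r mulmx_suml big_nat_cond big1// => j /andP[/andP[_ jM] _].
  have -> : const_mx 1 = toC (const_mx 1 : 'cV[R]_(N 0)).
    by apply/matrixP => u v; rewrite !mxE.
  rewrite -scalemxAl -toCM (Lmat_ones _ HS HG HC jM).
  by apply/matrixP => u v; rewrite !mxE mulr0.
have c0 j : c j != 0.
  apply/eqP => cj; have := cexpNK (e j); rewrite -/(c j) cj mulr0 => /esym/eqP.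
  by rewrite oner_eq0.
have cV j : s / c j = s * cexp (e j).
  by congr (_ * _); apply: (mulIf (c0 j)); rewrite mulVf// cexpNK.
rewrite (det_triangular_eq0 s0); last first.
  move=> i j /andP[ij jM]; rewrite -scalemxAl -scalemxAr -toCM.
  rewrite (Lmat_mul0 _ HG HC (ltn_trans ij jM) ij).
  by apply/matrixP => u v; rewrite !mxE !mulr0.
split=> [[j jM /(det_shift_eigenvalue _ _ (c0 j)) Ej]|].
  have nz : - (s / c j) != 0 by rewrite oppr_eq0 mulf_neq0// invr_neq0.
  case: j jM Ej nz => [|j] jM Ej nz.
    apply: Or32; exists (- (s / c 0%N)); split => //.
    by rewrite /c e0 oppr0 cexp0 divr1 subrr.
  apply: Or33; exists j.+1; split => //; exists (- (s / c j.+1)); split => //.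
  by rewrite cV subrr.
case=> [sE|[l [El l0 sl]]|[j [/andP[j1 jM] [l [El l0 sl]]]]].
- by rewrite sE eqxx in s0.
- exists 0%N => //; apply/(det_shift_eigenvalue _ _ (c0 _)).
  have -> // : - (s / c 0%N) = l.
  by rewrite /c e0 oppr0 cexp0 divr1; apply/eqP; rewrite eq_sym -addr_eq0 addrC sl.
- exists j => //; apply/(det_shift_eigenvalue _ _ (c0 _)).
  have -> // : - (s / c j) = l.
  by rewrite cV; apply/eqP; rewrite eq_sym -addr_eq0 addrC sl.
Qed.

End Characteristic.

(** * Existence of solutions *)

Section MethodOfSteps.
Context {R : realType}.

Lemma rder_trunc (f f' : R -> R) : rder 0 f f' ->
  rder 0 (fun t => if t < 0 then 0 else f t) f'.
Proof.
move=> [fc fd]; split=> t t0.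
  have H : (if u < 0 then 0 else f u) @[u --> t] --> f t.
    apply: (@cvg_near_eq _ _ _ _ f); last exact: fc.
    by near=> u; rewrite ltNge ltW//; near: u; exact: lt_nbhsr.
  have E : f t = (if t < 0 then 0 else f t) by rewrite ltNge (ltW t0).
  by rewrite E in H.
apply: (@rd_near _ f); last exact: fd.
  by rewrite ltNge t0.
apply/near_right0P; exists 1 => // h /andP[h0 _].
by rewrite ltNge addr_ge0// ltW.
Unshelve. all: by end_near. Qed.

Lemma rprim_local (p q : R -> R) T s : causal p -> causal q ->
  (forall u, u < T -> p u = q u) -> s < T -> rprim p s = rprim q s.
Proof.
move=> cp cq pq sT; have [s0|s0] := leP s 0; first by rewrite !rprim0.
lapply (rder_const (ltW s0) (rderB (rprimP 0 cp) (rprimP 0 cq))) => /=; last first.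
  by move=> u /andP[_ us]; rewrite pq ?subrr// (lt_trans us).
rewrite !(rprim0 _ (lexx 0)) subrr => /eqP; by rewrite subr_eq0 => /eqP.
Qed.

Context (n m : nat) (X : nat -> 'M[R]_n) (d : nat -> R) (x0 : 'cV[R]_n) (dl : R)
  (dl0 : 0 < dl) (dld : forall i, (i < m)%N -> dl <= d i).

(** The Picard operator of the integrated equation: as [z] vanishes before 0, the integral of
    [z (u - d j)] over [[0, t]] is the primitive of [z] at [t - d j]. *)
Definition step (z : R -> 'cV[R]_n) (t : R) : 'cV[R]_n := if t < 0 then 0 else
  x0 - \sum_(j < m) X j *m (\col_i rprim (fun u => z u i 0) (t - d j)).

Definition steps k : R -> 'cV[R]_n := iter k step (fun t => if t < 0 then 0 else x0).

Lemma steps_neg k t : t < 0 -> steps k t = 0.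
Proof. by case: k => [|k] t0; rewrite /steps /= /step t0. Qed.

Lemma step_rder (z : R -> 'cV[R]_n) : (forall i, causal (fun t => z t i 0)) -> forall i,
  rder 0 (fun t => step z t i 0) (fun t => - (\sum_(j < m) X j *m z (t - d j)) i 0).
Proof.
move=> zc i.
have -> : (fun t => step z t i 0) = fun t => if t < 0 then 0 else
    x0 i 0 - \sum_(j < m) \sum_l X j i l * rprim (fun u => z u l 0) (t - d j).
  apply/funext => t; rewrite /step; case: ifP => _; first by rewrite mxE.
  rewrite !mxE summxE; congr (_ - _); apply: eq_bigr => j _.
  by rewrite mxE; apply: eq_bigr => l _; rewrite mxE.
apply: rder_trunc.
have H := rderB (rder_cst 0 (x0 i 0)) (rder_sum (index_enum 'I_m) (P := xpredT)
  (fun (j : 'I_m) _ => rder_sum (index_enum 'I_n) (P := xpredT)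
    (fun (l : 'I_n) _ => rderZ (X j i l) (rder_shift (rprimP (0 - d j) (zc l)))))).
apply: rder_eq H => t _; rewrite sub0r summxE; congr (- _); apply: eq_bigr => j _.
by rewrite mxE.
Qed.

Lemma steps_causal k i : causal (fun t => steps k t i 0).
Proof.
elim: k i => [|k IH] i.
  apply: (@rder_causal _ _ (fun=> 0)) => [t t0|]; first by rewrite steps_neg// mxE.
  have -> : (fun t => steps 0 t i 0) = fun t => if t < 0 then 0 else x0 i 0.
    by apply/funext => t; rewrite /steps /=; case: ifP => //; rewrite mxE.
  by apply: rder_trunc; exact: rder_cst.
apply: rder_causal (step_rder IH i) => t t0.
by rewrite -[step _]/(steps k.+1) steps_neg// mxE.
Qed.

Lemma steps_rder k i : rder 0 (fun t => steps k.+1 t i 0)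
  (fun t => - (\sum_(j < m) X j *m steps k (t - d j)) i 0).
Proof. by apply: step_rder => l; exact: steps_causal. Qed.

Lemma steps0 k : steps k 0 = x0.
Proof.
case: k => [|k]; rewrite /steps /= /step ltxx// big1 ?subr0// => j _.
suff -> : \col_i rprim (fun u => steps k u i 0) (0 - d j) = 0 by rewrite mulmx0.
apply/colP => i; rewrite !mxE rprim0// sub0r oppr_le0 (le_trans (ltW dl0))//.
exact: dld.
Qed.

(** Every delay is at least [dl], so the iterate at [t] only depends on the previous one before
    [t - dl]. Each iteration thus settles the values on one more interval of length [dl]. *)
Lemma stepsS k t : t < k.+1%:R * dl -> steps k.+1 t = steps k t.
Proof.
have [t0 _|] := ltP t 0; first by rewrite !steps_neg.
elim: k t => [|k IH] t t0 tk.
  rewrite /steps /= /step ltNge t0/= big1 ?subr0// => j _.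
  suff -> : \col_i rprim (fun u => (if u < 0 then 0 else x0) i 0) (t - d j) = 0.
    by rewrite mulmx0.
  apply/colP => i; rewrite !mxE rprim0// subr_le0 (le_trans (ltW tk))// mul1r.
  exact: dld.
rewrite -[LHS]/(step (steps k.+1) t) -[RHS]/(step (steps k) t) /step ltNge t0/=.
congr (_ - _); apply: eq_bigr => j _; congr (_ *m _); apply/colP => i; rewrite !mxE.
apply: (rprim_local (steps_causal k.+1 i) (steps_causal k i) (T := k.+1%:R * dl)).
  by move=> u uk; have [u0|u0] := ltP u 0; [rewrite !steps_neg|rewrite IH].
by have := dld (ltn_ord j); move: tk; rewrite -[k.+2]addn1 natrD mulrDl mul1r; lra.
Qed.

Lemma steps_stable k l t : t < k.+1%:R * dl -> (k <= l)%N -> steps l t = steps k t.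
Proof.
move=> tk /subnKC <-; elim: (l - k)%N => [|p IH]; first by rewrite addn0.
rewrite addnS stepsS ?IH// (lt_le_trans tk)// ler_pM2r// ler_nat ltnS.
exact: leq_addr.
Qed.

Lemma delay_system_exists : exists z : R -> 'cV[R]_n,
  [/\ (forall t, t < 0 -> z t = 0), z 0 = x0 &
    forall i, rder 0 (fun t => z t i 0) (fun t => - (\sum_(j < m) X j *m z (t - d j)) i 0)].
Proof.
(* An iterate whose value at [t] is already final. *)
pose b t := Num.bound (t / dl).
have bP t : t < (b t).+1%:R * dl.
  have [t0|t0] := ltP t 0; first by rewrite (lt_le_trans t0)// mulr_ge0// ltW.
  rewrite -ltr_pdivrMr// (lt_trans (archi_boundP _)) ?divr_ge0// 1?ltW//.
  by rewrite ltr_nat.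
pose z t := steps (b t) t.
have zE k t : t < k.+1%:R * dl -> z t = steps k t.
  move=> tk; rewrite /z; have [kb|bk] := leqP k (b t); first exact: steps_stable.
  by symmetry; apply: steps_stable; [exact: bP|exact: ltnW].
exists z; split=> [t t0||i]; [exact: steps_neg|exact: steps0|].
(* Around [t] the solution coincides with one fixed iterate, from which continuity and the right
   derivative are inherited. The successor is there because [steps_rder] expresses the derivative of
   iterate [k.+1] by iterate [k]. *)
have loc t u : u < t + 1 -> z u i 0 = steps (b (t + 1)).+1 u i 0.
  move=> ut; rewrite (zE (b (t + 1)).+1)// (lt_trans ut)// (lt_trans (bP _))//.
  by rewrite ltr_pM2r// ltr_nat.
split=> t t0.
  have [H _] := steps_rder (b (t + 1)) i.
  have G : z u i 0 @[u --> t] --> steps (b (t + 1)).+1 t i 0.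
    apply: cvg_near_eq (H t t0); near=> u; rewrite (loc t)//.
    by near: u; apply: lt_nbhsl; rewrite ltrDl.
  by rewrite -(loc t) ?ltrDl// in G.
have [_ H] := steps_rder (b (t + 1)) i.
apply: (@rd_near _ (fun u => steps (b (t + 1)).+1 u i 0)).
- by rewrite (loc t)// ltrDl.
- by apply/near_right0P; exists 1 => // h /andP[_ h1]; rewrite (loc t)// ltrD2l.
rewrite (_ : \sum_(j < m) _ = \sum_(j < m) X j *m steps (b (t + 1)) (t - d j)); first exact: H.
apply: eq_bigr => j _; rewrite (zE (b (t + 1)))//; apply: le_lt_trans (bP (t + 1)).
by have := dld (ltn_ord j); move: dl0; lra.
Unshelve. all: by end_near. Qed.

End MethodOfSteps.

(** * Consensus *)

Lemma cvg_sumr {R : realType} (I T : Type) (s : seq I) (F : set_system T) {FF : Filter F}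
    (f : I -> T -> R) (l : I -> R) : (forall i, f i @ F --> l i) ->
  (fun t => \sum_(i <- s) f i t) @ F --> \sum_(i <- s) l i.
Proof.
move=> fl; elim: s => [|i s IH].
  by rewrite big_nil; under eq_fun do rewrite big_nil; exact: cvg_cst.
by rewrite big_cons; under eq_fun do rewrite big_cons; apply: cvgD.
Qed.

Section Consensus.
Context {R : realType} (M : nat) (N : nat -> nat) (k : nat -> nat -> nat)
  (A : forall j, 'M[R]_(N j)) (a : 'I_(N 0%N) -> R) (C : forall j, 'M[R]_(N j.+1, N j))
  (tau : nat -> R)
  (HS : hier_struct M N k) (HG : graph_struct M N k A) (a_gt0 : forall i, 0 < a i)
  (HC : C_struct N k M C) (tau_ge0 : forall j, (j.+1 < M)%N -> 0 <= tau j).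

Local Notation B := (@Bmx R N k).
Local Notation Bp := (@Bprod R N k).
Local Notation Cp := (Cprod N C).
Local Notation L := (Lmat N k A a C).
Local Notation S := (Smat k A a).

Lemma cum_le i j : (i <= j < M)%N -> cum tau i <= cum tau j.
Proof.
move=> /andP[/subnKC <-]; elim: (j - i)%N => [|m IH] jM; first by rewrite addn0.
rewrite addnS in jM *; apply: (le_trans (IH (ltnW jM))).
by rewrite /cum big_ord_recr/= lerDl tau_ge0.
Qed.

Lemma cum0 : cum tau 0 = 0.
Proof. by rewrite /cum big_ord0. Qed.

Lemma cum_ge0 j : (j < M)%N -> 0 <= cum tau j.
Proof. by move=> jM; rewrite -cum0 cum_le. Qed.

Lemma consensusE (x0 : 'cV[R]_(N 0)) :
  consensus a x0 = ((\row_i a i *m x0) 0 0 / \sum_i a i) *: const_mx 1.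
Proof.
have rE : (const_mx 1 : 'cV[R]_(N 0))^T *m diag_mx (\row_i a i) = \row_i a i.
  by apply/rowP => i; rewrite mul_mx_diag !mxE mul1r.
rewrite /consensus -!mulmxA [_ *m (diag_mx _ *m x0)]mulmxA rE.
rewrite [_ *m (diag_mx _ *m const_mx 1)]mulmxA rE.
have -> : (\row_i a i *m (const_mx 1 : 'cV[R]_(N 0))) ord0 ord0 = \sum_i a i.
  by rewrite mxE; apply: eq_bigr => i _; rewrite !mxE mulr1.
rewrite [\row_i a i *m x0]mx11_scalar mul_mx_scalar scalerA mulrC.
by congr (_ *: _); rewrite [in RHS]mxE mulr1n.
Qed.

(** The closed equation of the physical layer; [2 * cum tau j] is the travel time up to layer [j]
    and back. *)
Definition reduced (z : R -> 'cV[R]_(N 0)) := (forall t, t < 0 -> z t = 0) /\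
  (forall i, rder 0 (fun t => z t i 0)
     (fun t => - (\sum_(j < M) L j *m z (t - 2 * cum tau j)) i 0)).

Lemma solution_reduced x0 x y : is_solution N k M A a C tau x0 x y -> reduced (x 0%N).
Proof.
move=> [neg _ xE yE [yM xD]]; have [M2 _ _ _] := HS.
have M0 : (0 < M)%N by exact: leq_trans M2.
(* The interlayer equations, required from time 0 on, extend to negative times because both sides
   vanish there. *)
have xS j t : (j.+1 < M)%N -> x j.+1 t = C j *m x j (t - tau j).
  move=> jM; have [t0|t0] := ltP t 0; last exact: xE.
  rewrite (neg _ _ jM t0).1 (neg j (t - tau j) (ltnW jM) _).1 ?mulmx0//.
  by have := tau_ge0 jM; lra.
have yS j t : (j.+1 < M)%N ->
    y j t = B j *m (- S j.+1 *m x j.+1 (t - tau j) + y j.+1 (t - tau j)).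
  move=> jM; have [t0|t0] := ltP t 0; last exact: yE.
  have tt : t - tau j < 0 by have := tau_ge0 jM; lra.
  by rewrite (neg _ _ (ltnW jM) t0).2 (neg _ _ jM tt).1 (neg _ _ jM tt).2 mulmx0 addr0 mulmx0.
have xCp j t : (j < M)%N -> x j t = Cp j *m x 0%N (t - cum tau j).
  elim: j t => [|j IH] t jM; first by rewrite mul1mx cum0 subr0.
  rewrite xS// IH ?(ltnW jM)// mulmxA; congr (_ *m x 0%N _).
  by rewrite /cum big_ord_recr/=; ring.
(* Each induction step peels one layer off the feedback. At the top layer the remainder [y M.-1] is
   zero. *)
have y0E n t : (n < M)%N -> y 0%N t =
    - (\sum_(1 <= j < n.+1) L j *m x 0%N (t - 2 * cum tau j)) + Bp n *m y n (t - cum tau n).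
  elim: n => [|n IH] nM; first by rewrite big_geq// oppr0 add0r mul1mx cum0 subr0.
  rewrite (IH (ltnW nM)) [in RHS]big_nat_recr//= opprD -addrA; congr (_ + _).
  rewrite yS// mulmxA mulmxDr mulNmx mulmxN (xCp n.+1)//; congr (_ + _); last first.
    by congr (_ *m y _ _); rewrite /cum big_ord_recr/=; ring.
  congr (- _); rewrite LmatE /= !mulmxA; congr (_ *m x 0%N _).
  by rewrite /cum big_ord_recr/=; ring.
split=> [t t0|i]; first by have [] := neg _ _ M0 t0.
have [xc xd] := xD i; split=> // t t0.
have y0 : y 0%N t = - \sum_(1 <= j < M) L j *m x 0%N (t - 2 * cum tau j).
  by rewrite (y0E M.-1) ?prednK// yM mulmx0 addr0.
have E : - (Kmx N k a 0 *m lapl (A 0%N)) *m x 0%N t + y 0%N t =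
    - \sum_(j < M) L j *m x 0%N (t - 2 * cum tau j).
  rewrite y0 -(big_mkord xpredT (fun j => L j *m x 0%N (t - 2 * cum tau j))) big_ltn//.
  by rewrite opprD cum0 mulr0 subr0 LmatE /= mul1mx mulmx1 mulNmx.
have H := xd t t0; rewrite E mxE in H; exact: H.
Qed.

(** * Scalar observations of the reduced system *)

Section Reduced.
Context (z : R -> 'cV[R]_(N 0)) (zR : reduced z).

Definition obs (r : 'rV[R]_(N 0)) t := (r *m z t) 0 0.

Lemma obsE r t : obs r t = \sum_i r 0 i * z t i 0.
Proof. by rewrite /obs mxE. Qed.

Lemma obsD r s t : obs (r + s) t = obs r t + obs s t.
Proof. by rewrite /obs mulmxDl mxE. Qed.

Lemma obsZ c r t : obs (c *: r) t = c * obs r t.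
Proof. by rewrite /obs -scalemxAl mxE. Qed.

Lemma obs0 t : obs 0 t = 0.
Proof. by rewrite /obs mul0mx mxE. Qed.

Lemma obs_neg r t : t < 0 -> obs r t = 0.
Proof. by move=> t0; rewrite /obs zR.1// mulmx0 mxE. Qed.

Lemma obs_rder r : rder 0 (obs r)
  (fun t => - \sum_(j < M) obs (r *m L j) (t - 2 * cum tau j)).
Proof.
have -> : obs r = fun t => \sum_i r 0 i * z t i 0 by apply/funext => t; exact: obsE.
have H := rder_sum (index_enum 'I_(N 0)) (P := xpredT)
  (fun (i : 'I_(N 0)) _ => rderZ (r 0 i) (zR.2 i)).
apply: rder_eq H => t _.
transitivity (- (r *m \sum_(j < M) L j *m z (t - 2 * cum tau j)) 0 0).
  by rewrite mxE -sumrN; apply: eq_bigr => i _; rewrite mulrN.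
rewrite mulmx_sumr summxE; congr (- _); apply: eq_bigr => j _.
by rewrite /obs mulmxA.
Qed.

Lemma obs_causal r : causal (obs r).
Proof. by apply: rder_causal (obs_rder r) => t; exact: obs_neg. Qed.

Lemma obs_arow t : 0 <= t -> obs (\row_i a i) t = obs (\row_i a i) 0.
Proof.
move=> t0; apply: rder_const t0 (obs_rder _) _ => u _.
rewrite big1 ?oppr0// => j _.
by rewrite (arow_Lmat C HS HG a_gt0 (ltn_ord j)) obs0.
Qed.

(** For a layer [i] above [j], [l *: (r *m Cp j *m Bp i) = r *m S j *m Cp j *m Bp i = 0], and [l]
    can be cancelled. Hence the observation by [r *m Cp j] is driven only by itself and by lower
    layers. *)
Lemma eigenrow_Lmat j (r : 'rV[R]_(N j)) l i : (j < M)%N -> r *m S j = l *: r -> l != 0 ->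
  (j <= i)%N -> r *m Cp j *m L i = (if i == j then l else 0) *: (r *m Cp j).
Proof.
move=> jM rS l0; rewrite leq_eqVlt => /predU1P[<-|ji].
  rewrite eqxx LmatE !mulmxA -(mulmxA r) (Cp_Bp HC jM) mulmx1 -(mulmxA r) -/(S j) rS.
  by rewrite scalemxAl.
rewrite gtn_eqF// scale0r LmatE !mulmxA.
suff -> : r *m Cp j *m Bp i = 0 by rewrite !mul0mx.
apply: (scalerI l0); rewrite scaler0 !scalemxAl -rS -(mulmxA r (S j)) -(mulmxA r).
by rewrite (Smat_Cp_Bp a HG HC jM ji) mulmx0.
Qed.

Lemma obs_Lmat_sqdom : (forall j, (1 <= j < M)%N -> forall lmax, is_max_eig (L j) lmax ->
    4 * lmax * cum tau j < pi) ->
  forall j, (j < M)%N -> forall q, sqdom (obs (q *m L j)).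
Proof.
move=> cond j; elim/ltn_ind: j => j IH jM q; rewrite LmatE !mulmxA -(mulmxA (q *m Bp j)).
move: (q *m Bp j) => {}q.
apply: (Smat_eigenrow_ind HS HG a_gt0 (G := fun q => sqdom (obs (q *m S j *m Cp j))) jM).
- rewrite !mul0mx (_ : obs 0 = fun=> 0); first exact: sqdom0.
  by apply/funext => t; rewrite obs0.
- move=> u v Gu Gv; rewrite !mulmxDl.
  rewrite (_ : obs _ = fun t => obs (u *m S j *m Cp j) t + obs (v *m S j *m Cp j) t).
    exact: sqdomD.
  by apply/funext => t; rewrite obsD.
move=> r l rS; rewrite rS -scalemxAl.
rewrite (_ : obs _ = fun t => l * obs (r *m Cp j) t); last first.
  by apply/funext => t; rewrite obsZ.
have [->|r0] := eqVneq r 0.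
  rewrite mul0mx (_ : (fun t => _) = fun=> 0); first exact: sqdom0.
  by apply/funext => t; rewrite obs0 mulr0.
have [->|l0] := eqVneq l 0.
  rewrite (_ : (fun t => _) = fun=> 0); first exact: sqdom0.
  by apply/funext => t; rewrite mul0r.
have lgt : 0 < l by rewrite lt_neqAle eq_sym l0 (Smat_eig_ge0 HS HG a_gt0 jM rS).
have c0 := cum_ge0 jM.
(* The condition bounds the largest eigenvalue of [L j], and [l] is one of its eigenvalues; for
   [j = 0] the delay is zero. *)
have ld : l * (2 * cum tau j) < pi / 2.
  have pi0 := pi_gt0 R.
  case: (posnP j) => [->|j0]; first by rewrite cum0 !mulr0 divr_gt0.
  have El := Lmat_eigenvalue HC jM rS r0.
  have [m mP] := eigenvalue_max El; have lm := mP.2 _ El.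
  have := cond j; rewrite j0 jM => /(_ isT _ mP).
  by have := ler_wpM2r c0 lm; lra.
apply: sqdomZ; pose rho := r *m Cp j.
(* The input from the lower layers, square integrable by the induction hypothesis. *)
pose f t := - \sum_(i < M | (i < j)%N) obs (rho *m L i) (t - 2 * cum tau i).
apply: (@delay_sqdom _ l (2 * cum tau j) _ f) => //.
- by rewrite mulr_ge0.
- by move=> t; exact: obs_neg.
- apply: rder_eq (obs_rder rho) => t _.
  rewrite (bigID (fun i : 'I_M => (i < j)%N))/= opprD addrC; congr (_ + _).
  rewrite (bigD1 (Ordinal jM)) ?ltnn//= big1 ?addr0.
    by rewrite (eigenrow_Lmat jM rS l0 (leqnn j)) eqxx obsZ mulNr.
  move=> i /andP[]; rewrite -leqNgt => ji ij.
  rewrite (eigenrow_Lmat jM rS l0 ji) ifF ?scale0r ?obs0//.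
  by apply: contraNF ij => /eqP ij; apply/eqP/val_inj.
- rewrite (_ : f = fun t => (-1) * \sum_(i < M | (i < j)%N) obs (rho *m L i) (t - 2 * cum tau i)).
    apply: sqdomZ; apply: sqdom_sum => i ij; apply: sqdom_shift; first exact: obs_causal.
    exact: IH.
  by apply/funext => t; rewrite mulN1r.
Qed.

Lemma reduced_consensus : (forall j, (1 <= j < M)%N -> forall lmax, is_max_eig (L j) lmax ->
    4 * lmax * cum tau j < pi) ->
  forall i, (fun t => z t i ord0) @ +oo --> consensus a (z 0) i ord0.
Proof.
move=> cond i.
pose s := \sum_i a i.
have s0 : s != 0.
  rewrite gt_eqF// /s (bigD1 i)//=; apply: ltr_pwDl => //.
  by apply: sumr_ge0 => u _; exact: ltW.
(* The deviation of node [i] from the conserved weighted mean. It annihilates constants, so by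
   [row_sum_Lmat] it is a combination of rows of the [L j], and [sqdom_cvg0] applies to it. *)
pose rho := delta_mx 0 i - s^-1 *: \row_i a i.
have rho1 : rho *m const_mx 1 = 0 :> 'cV[R]_1.
  apply/colP => u; rewrite ord1 mulmxBl -scalemxAl -rowE !mxE.
  rewrite (eq_bigr a) => [|l _]; last by rewrite !mxE mulr1.
  by rewrite mulVf// subrr.
have [q rhoE] := row_sum_Lmat HS HG a_gt0 HC rho1.
have sq r : (exists q : 'I_M -> 'rV[R]_(N 0), r = \sum_j q j *m L j) -> sqdom (obs r).
  move=> [p ->].
  rewrite (_ : obs _ = fun t => \sum_j obs (p j *m L j) t).
    by apply: sqdom_sum => j _; exact: obs_Lmat_sqdom.
  by apply/funext => t; rewrite /obs mulmx_suml summxE.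
have rc : obs rho @ +oo --> 0.
  apply: sqdom_cvg0 (obs_causal _) (obs_rder _) _ _; first by apply: sq; exists q.
  rewrite (_ : (fun t => _) = fun t => (-1) * \sum_(j < M) obs (rho *m L j) (t - 2 * cum tau j)).
    apply: sqdomZ; apply: sqdom_sum => j _; apply: sqdom_shift; first exact: obs_causal.
    exact: obs_Lmat_sqdom.
  by apply/funext => t; rewrite mulN1r.
rewrite consensusE !mxE mulr1 -/s.
have H : (fun t => obs rho t + (\row_i a i *m z 0) 0 0 / s) @ +oo -->
    0 + (\row_i a i *m z 0) 0 0 / s.
  by apply: cvgD => //; exact: cvg_cst.
rewrite add0r in H; rewrite !mxE in H; apply: cvg_near_eq H; near=> t.
have t0 : 0 <= t by near: t; apply: nbhs_pinfty_ge; exact: num_real.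
rewrite /rho obsD -scaleNr obsZ obs_arow// /obs -rowE !mxE mulNr mulrC addrNK//.
Unshelve. all: by end_near. Qed.

End Reduced.

Lemma reduced_solution z : reduced z ->
  exists x y, is_solution N k M A a C tau (z 0) x y /\ x 0%N = z.
Proof.
move=> [zneg zD]; have [M2 _ _ _] := HS; have M0 : (0 < M)%N by exact: leq_trans M2.
pose x j t := Cp j *m z (t - cum tau j).
(* The feedback collected at layer [j] from all layers above. The delay is the way up from the
   physical layer to [i] and down to [j] only, that is [2 * cum tau i - cum tau j]. *)
pose y j t := - \sum_(i < M | (j < i)%N) Cp j *m L i *m z (t - 2 * cum tau i + cum tau j).
have x0E : x 0%N = z by apply/funext => t; rewrite /x cum0 subr0 mul1mx.
(* For [j < i] the range of [L i] lies in that of [Bp j.+1], on which [Bp j.+1 *m Cp j.+1] is the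
   identity. *)
have BCL i j : (j.+1 < M)%N -> (j < i)%N -> B j *m Cp j.+1 *m L i = Cp j *m L i.
  move=> jM ji.
  have ELi : Bp j.+1 *m Cp j.+1 *m L i = L i.
    by rewrite LmatE 2!(mulmxA (Bp j.+1 *m Cp j.+1)) (Bp_Cp_Bp HC jM ji).
  by rewrite -[in RHS]ELi /= !mulmxA (Cp_Bp HC (ltnW jM)) mul1mx.
exists x, y; split=> //; split.
- move=> j t jM t0; split; first by rewrite /x zneg ?mulmx0//; have := cum_ge0 jM; lra.
  rewrite /y big1 ?oppr0// => i ji.
  rewrite zneg ?mulmx0//; have := @cum_le j i; rewrite (ltnW ji) ltn_ord => /(_ isT).
  by have := cum_ge0 (ltn_ord i); lra.
- by rewrite x0E.
- move=> j t jM t0; rewrite /x /= mulmxA; congr (_ *m z _).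
  by rewrite /cum big_ord_recr/=; ring.
- move=> j t jM t0; rewrite /y (bigD1 (Ordinal jM))//= opprD mulmxDr; congr (_ + _).
    rewrite -/(S j.+1) mulNmx mulmxN /x LmatE /= !mulmxA (Cp_Bp HC (ltnW jM)) mul1mx.
    by congr (- (_ *m z _)); rewrite /cum !big_ord_recr/=; ring.
  rewrite mulmxN mulmx_sumr; congr (- _); apply: eq_big => [i|i /andP[ji _]].
    rewrite [RHS]ltn_neqAle andbC eq_sym; congr (~~ _ && _).
  rewrite [RHS]mulmxA (mulmxA (B j) (Cp j.+1) (L i)) (BCL _ _ jM ji); congr (_ *m z _).
  by rewrite /cum !big_ord_recr/=; ring.
split.
  move=> t; rewrite /y big1 ?oppr0// => i; rewrite ltnNge => /negP[].
  by rewrite -ltnS prednK.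
move=> i; have [zc zd] := zD i; rewrite x0E; split=> // t t0.
have -> : - (Kmx N k a 0 *m lapl (A 0%N)) *m z t + y 0%N t =
    - \sum_(j < M) L j *m z (t - 2 * cum tau j).
  rewrite /y [in RHS](bigD1 (Ordinal M0))//= opprD; congr (_ + _).
    by rewrite cum0 mulr0 subr0 LmatE /= mul1mx mulmx1 mulNmx.
  congr (- _); apply: eq_big => [u|u _]; first by rewrite lt0n.
  by rewrite cum0 addr0 mul1mx.
by rewrite mxE; exact: zd.
Qed.

Lemma consensus_delay_bound :
  (forall (x0 : 'cV[R]_(N 0%N)) (x y : forall j, R -> 'cV[R]_(N j)),
      is_solution N k M A a C tau x0 x y ->
      forall i, (fun t => x 0%N t i ord0) @ +oo --> consensus a x0 i ord0) ->
  forall j, (1 <= j < M)%N -> forall lmax, is_max_eig (L j) lmax -> 4 * lmax * cum tau j < pi.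
Proof.
move=> cons j /andP[j1 jM] l [lE _]; rewrite ltNge; apply/negP => ld.
have pi0 := pi_gt0 R; have c0 := cum_ge0 jM.
have cgt : 0 < cum tau j.
  rewrite lt_neqAle c0 andbT; apply: contraTneq ld => <-; rewrite mulr0 -ltNge//.
have lgt : 0 < l.
  rewrite ltNge; apply/negP => l0; have := mulr_le0_ge0 l0 c0; lra.
have [r rS r0] := eigenvalue_Lmat HC jM lE (lt0r_neq0 lgt).
(* Layers below [j] are switched off. The maximum in [d] gives all delays the common positive lower
   bound required by the method of steps, and does not change those of layers [i >= j], where
   [cum tau j <= cum tau i]. *)
pose X i : 'M[R]_(N 0) := if (j <= i)%N then L i else 0.
pose d i := Num.max (2 * cum tau i) (2 * cum tau j).
have dl0 : 0 < 2 * cum tau j by lra.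
have dld i : (i < M)%N -> 2 * cum tau j <= d i by move=> _; rewrite le_max lexx orbT.
have [z [zneg z0 zD]] := delay_system_exists X (Bp j *m r^T) dl0 dld.
(* The projection onto the range of [Bp j]. It fixes the initial value and the ranges of all [X i],
   so [z] never leaves this range; there the omitted [L i] vanish, and [z] solves the full
   equation. *)
pose E := Bp j *m Cp j.
have EX i : E *m X i = X i.
  rewrite /X; case: ifP => ji; last by rewrite mulmx0.
  by rewrite LmatE !mulmxA (Bp_Cp_Bp HC jM ji).
have zE t : E *m z t = z t.
  have [t0|t0] := ltP t 0; first by rewrite zneg// mulmx0.
  apply/eqP; rewrite -subr_eq0 -[X in _ - X]mul1mx -mulmxBl; apply/eqP/colP => u.
  pose rho := row u (E - 1%:M).
  have rhoX i : rho *m X i = 0 by rewrite -row_mul mulmxBl EX mul1mx subrr row0.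
  have -> : ((E - 1%:M) *m z t) u 0 = \sum_i rho 0 i * z t i 0.
    by rewrite mxE; apply: eq_bigr => i _; rewrite [in RHS]mxE.
  have H := rder_sum (index_enum 'I_(N 0)) (P := xpredT)
    (fun (i : 'I_(N 0)) _ => rderZ (rho 0 i) (zD i)).
  rewrite [in RHS]mxE (rder_const t0 H); last first.
    move=> v _; transitivity (- (rho *m \sum_(i < M) X i *m z (v - d i)) 0 0).
      by rewrite mxE -sumrN; apply: eq_bigr => i _; rewrite mulrN.
    rewrite mulmx_sumr big1 ?mxE ?oppr0// => i _.
    by rewrite mulmxA rhoX mul0mx.
  transitivity ((rho *m z 0) 0 0); first by rewrite mxE.
  by rewrite z0 -row_mul mulmxBl mulmxA (Bp_Cp_Bp HC jM (leqnn j)) mul1mx subrr row0 mxE.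
have zR : reduced z.
  split=> // i; apply: rder_eq (zD i) => t _.
  suff -> : \sum_(j < M) X j *m z (t - d j) = \sum_(j < M) L j *m z (t - 2 * cum tau j) by [].
  apply: eq_bigr => u _; rewrite /X; case: leqP => [ju|uj].
    rewrite /d max_l// ler_pM2l//; apply: cum_le; rewrite ju; exact: ltn_ord.
  by rewrite mul0mx -zE !mulmxA (Lmat_Bp _ HG HC (ltn_ord u) uj) !mul0mx.
have [x [y [sol xz]]] := reduced_solution zR.
have zcv i : (fun t => z t i ord0) @ +oo --> consensus a (z 0) i ord0.
  by have := cons _ _ _ sol i; rewrite xz.
pose rho := r *m Cp j.
(* Constants are invisible to [rho], so convergence to consensus sends this observation to 0. *)
have rho1 : rho *m const_mx 1 = 0 :> 'cV[R]_1.
  apply: (scalerI (lt0r_neq0 lgt)); rewrite scaler0 /rho !scalemxAl -rS.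
  rewrite -(Bp_ones HS (leqnn M)) mulmxA -(mulmxA r (S j)) -(mulmxA r).
  by rewrite (Smat_Cp_Bp a HG HC jM jM) mulmx0 mul0mx.
have ocv : obs z rho @ +oo --> 0.
  have -> : obs z rho = fun t => \sum_i rho 0 i * z t i 0.
    by apply/funext => t; exact: obsE.
  rewrite -[X in _ --> X](_ : \sum_i rho 0 i * consensus a (z 0) i ord0 = 0); last first.
    transitivity ((rho *m consensus a (z 0)) 0 0); first by rewrite mxE.
    by rewrite consensusE -scalemxAr rho1 scaler0 mxE.
  have H i : (fun t => rho 0 i * z t i 0) @ +oo --> rho 0 i * consensus a (z 0) i ord0.
    by apply: cvgM; [exact: cvg_cst|exact: zcv].
  exact: (cvg_sumr H).
have lpi : pi / 2 <= l * (2 * cum tau j) by lra.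
have oD : rder 0 (obs z rho) (fun t => - l * obs z rho (t - 2 * cum tau j)).
  apply: rder_eq (obs_rder zR rho) => t _; rewrite (bigD1 (Ordinal jM))//= big1 ?addr0.
    by rewrite (eigenrow_Lmat jM rS (lt0r_neq0 lgt) (leqnn j)) eqxx obsZ mulNr.
  move=> i ij; have [ji|uj] := leqP j i.
    rewrite (eigenrow_Lmat jM rS (lt0r_neq0 lgt) ji) ifF ?scale0r ?obs0//.
    by apply: contraNF ij => /eqP ij; apply/eqP/val_inj.
  have Lz u : L i *m z u = 0.
    by rewrite -zE !mulmxA (Lmat_Bp _ HG HC (ltn_ord i) uj) !mul0mx.
  by rewrite /obs -mulmxA Lz mulmx0 mxE.
have := delay_not_cvg0 lgt (ltW dl0) lpi (fun t => obs_neg zR rho (t := t)) oD ocv.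
(* At time 0 the observation is [r *m r^T], the sum of squares of a nonzero row. *)
rewrite /obs z0 mulmxA -(mulmxA r) (Cp_Bp HC jM) mulmx1 mxE => /eqP.
rewrite psumr_eq0 => [/allP rr|i _]; last by rewrite mxE -expr2 sqr_ge0.
case/rV0Pn : r0 => i /negP; apply.
by have := rr i; rewrite mem_index_enum => /(_ isT); rewrite mxE mulf_eq0 orbb.
Qed.

End Consensus.

Unset Implicit Arguments.
Local Open Scope complex_scope.

Theorem theorem7 (R : realType) (M : nat) (N : nat -> nat) (k : nat -> nat -> nat)
    (A : forall j, 'M[R]_(N j)) (a : 'I_(N 0%N) -> R)
    (C : forall j, 'M[R]_(N j.+1, N j)) (tau : nat -> R) :
  hier_struct M N k ->
  graph_struct M N k A ->
  (forall i, 0 < a i) ->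
  C_struct N k M C ->
  (forall j, (j.+1 < M)%N -> 0 <= tau j) ->
  let L := Lmat N k A a C in
  (forall s : R[i],
      \det (s%:M + toC (L 0%N)
            + \sum_(1 <= j < M) cexp (- (2%:R * s * (cum tau j)%:C)) *: toC (L j)) = 0
      <->
      [\/ s = 0,
          exists lam, [/\ ceig (L 0%N) lam, lam != 0 & s + lam = 0] |
          exists j, (1 <= j < M)%N /\
            exists lam, [/\ ceig (L j) lam, lam != 0 &
                            s * cexp (2%:R * s * (cum tau j)%:C) + lam = 0]])
  /\
  ((forall (x0 : 'cV[R]_(N 0%N)) (x y : forall j, R -> 'cV[R]_(N j)),
      is_solution N k M A a C tau x0 x y ->
      forall i, (fun t => x 0%N t i ord0) @ +oo --> consensus a x0 i ord0)
   <->
   (forall j, (1 <= j < M)%N ->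
      forall lmax, is_max_eig (L j) lmax -> 4%:R * lmax * cum tau j < pi)).
Proof.
move=> HS HG a_gt0 HC tau_ge0; split; first exact: characteristic_roots.
split; first exact: consensus_delay_bound.
move=> cond x0 x y sol; have zR := solution_reduced HS tau_ge0 sol.
have [_ <- _ _ _] := sol.
exact: reduced_consensus cond.
Qed.
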